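(* Let $\mathcal{A}$ be a computable equivalence structure with degree of bi-embeddable categoricity $\mathbf{0}'$. (1) If $\mathcal{A}$ has no infinite equivalence classes, then the index set $\{e : \mathcal{C}_e \text{ is bi-embeddable with } \mathcal{A}\}$ is $\Pi^0_3$-complete. (2) If $\mathcal{A}$ has $k$ infinite equivalence classes, where $0<k<\omega$, then the index set $\{e : \mathcal{C}_e \text{ is bi-embeddable with } \mathcal{A}\}$ is $D^0_3$-complete.
   Context: An equivalence structure $\mathcal{A}=(A,E)$ has universe $A\subseteq\omega$ and an equivalence relation $E$ on $A$; it is computable if its atomic diagram is computable. Two structures are bi-embeddable if each embeds into the other. The degree of bi-embeddable categoricity of a computable structure $\mathcal{A}$ is the least Turing degree $\mathbf{d}$ (if it exists) such that for any two computable structures bi-embeddable with $\mathcal{A}$, $\mathbf{d}$ computes embeddings between them in both directions. $(\mathcal{C}_e)_{e\in\omega}$ is the enumeration of partial computable equivalence structures: for the $e$-th partial computable function $\phi_e:\omega\times\omega\to\{0,1\}$, $\mathcal{C}_e$ has universe $\omega$ and $x E^{\mathcal{C}_e} y$ iff $\phi_e(x,y)=1$. A set is $D^0_n$ if it is the intersection of a $\Sigma^0_n$ set and a $\Pi^0_n$ set. For a class $\Gamma$, a set is $\Gamma$-complete if it is in $\Gamma$ and every set in $\Gamma$ is many-one reducible to it via a computable function. *)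

(* Defs.v *)
From Stdlib Require Import Arith List.
Import ListNotations.

Definition pair (x y : nat) : nat := (x + y) * (x + y + 1) / 2 + y.
Definition unpair_w (n : nat) : nat := (Nat.sqrt (8 * n + 1) - 1) / 2.
Definition psnd (n : nat) : nat :=
  let w := unpair_w n in n - w * (w + 1) / 2.
Definition pfst (n : nat) : nat := unpair_w n - psnd n.

Inductive code : Type :=
| CZero
| CSucc
| CId
| CFst
| CSnd
| COrc
| CComp (g f : code)
| CPair (f g : code)
| CPrec (f g : code)
| CMu (f : code).

Inductive ev (O : nat -> bool) : code -> nat -> nat -> Prop :=
| ev_zero x : ev O CZero x 0
| ev_succ x : ev O CSucc x (S x)
| ev_id x : ev O CId x x
| ev_fst x : ev O CFst x (pfst x)
| ev_snd x : ev O CSnd x (psnd x)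
| ev_orc x : ev O COrc x (if O x then 1 else 0)
| ev_comp g f x y z : ev O f x y -> ev O g y z -> ev O (CComp g f) x z
| ev_pair f g x a b : ev O f x a -> ev O g x b -> ev O (CPair f g) x (pair a b)
| ev_prec0 f g x y : ev O f x y -> ev O (CPrec f g) (pair x 0) y
| ev_precS f g x n r y :
    ev O (CPrec f g) (pair x n) r -> ev O g (pair x (pair n r)) y ->
    ev O (CPrec f g) (pair x (S n)) y
| ev_mu f x n :
    ev O f (pair x n) 0 ->
    (forall m, m < n -> exists v, v <> 0 /\ ev O f (pair x m) v) ->
    ev O (CMu f) x n.

(** Goedel numbering of programs (onto). *)
Fixpoint decode (fuel n : nat) : code :=
  match fuel with
  | 0 => CZero
  | S fu =>
    let k := n / 10 in
    match n mod 10 with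
    | 0 => CZero | 1 => CSucc | 2 => CId | 3 => CFst | 4 => CSnd | 5 => COrc
    | 6 => CComp (decode fu (pfst k)) (decode fu (psnd k))
    | 7 => CPair (decode fu (pfst k)) (decode fu (psnd k))
    | 8 => CPrec (decode fu (pfst k)) (decode fu (psnd k))
    | _ => CMu (decode fu k)
    end
  end.

Definition prog (e : nat) : code := decode (S e) e.

Definition phi (X : nat -> bool) (e x y : nat) : Prop := ev X (prog e) x y.

Definition empty_oracle : nat -> bool := fun _ => false.

Definition computable_in (X : nat -> bool) (f : nat -> nat) : Prop :=
  exists e, forall x, phi X e x (f x).

Definition computable (f : nat -> nat) : Prop := computable_in empty_oracle f.

Definition b2n (b : bool) : nat := if b then 1 else 0.

Definition computable_bool (R : nat -> bool) : Prop :=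
  computable (fun n => b2n (R n)).

Definition turing_red (X Y : nat -> bool) : Prop :=
  computable_in Y (fun n => b2n (X n)).

Definition halting (e : nat) : Prop := exists y, phi empty_oracle e e y.

Definition is_char (P : nat -> Prop) (X : nat -> bool) : Prop :=
  forall n, P n <-> X n = true.

Definition Sigma3 (S : nat -> Prop) : Prop :=
  exists R : nat -> bool, computable_bool R /\
    forall x, S x <-> exists a, forall b, exists c,
      R (pair x (pair a (pair b c))) = true.

Definition Pi3 (S : nat -> Prop) : Prop :=
  exists R : nat -> bool, computable_bool R /\
    forall x, S x <-> forall a, exists b, forall c,
      R (pair x (pair a (pair b c))) = true.

Definition D3 (S : nat -> Prop) : Prop :=
  exists S1 S2, Sigma3 S1 /\ Pi3 S2 /\ forall x, S x <-> (S1 x /\ S2 x).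

Definition m_reducible (T S : nat -> Prop) : Prop :=
  exists f, computable f /\ forall x, T x <-> S (f x).

Definition complete (Gamma : (nat -> Prop) -> Prop) (S : nat -> Prop) : Prop :=
  Gamma S /\ forall T, Gamma T -> m_reducible T S.

Record str : Type := Str { dom : nat -> Prop; rel : nat -> nat -> Prop }.

Definition is_eq_str (S : str) : Prop :=
  (forall x, dom S x -> rel S x x) /\
  (forall x y, dom S x -> dom S y -> rel S x y -> rel S y x) /\
  (forall x y z, dom S x -> dom S y -> dom S z ->
     rel S x y -> rel S y z -> rel S x z).

Definition computable_str (S : str) : Prop :=
  exists (d : nat -> bool) (r : nat -> nat -> bool),
    (forall x, dom S x <-> d x = true) /\
    (forall x y, rel S x y <-> r x y = true) /\
    computable_bool d /\ computable_bool (fun n => r (pfst n) (psnd n)).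

Definition embedding (S T : str) (f : nat -> nat) : Prop :=
  (forall x, dom S x -> dom T (f x)) /\
  (forall x y, dom S x -> dom S y -> f x = f y -> x = y) /\
  (forall x y, dom S x -> dom S y -> (rel S x y <-> rel T (f x) (f y))).

Definition bi_embeddable (S T : str) : Prop :=
  (exists f, embedding S T f) /\ (exists g, embedding T S g).

Definition bi_emb_cat_relative (X : nat -> bool) (A : str) : Prop :=
  forall B C : str,
    computable_str B -> is_eq_str B -> computable_str C -> is_eq_str C ->
    bi_embeddable B A -> bi_embeddable C A ->
    (exists f, computable_in X f /\ embedding B C f) /\
    (exists g, computable_in X g /\ embedding C B g).

Definition bec_degree_is_0' (A : str) : Prop :=
  (forall K, is_char halting K -> bi_emb_cat_relative K A) /\
  (forall X, bi_emb_cat_relative X A ->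
     forall K, is_char halting K -> turing_red K X).

Definition Ce (e : nat) : str :=
  Str (fun _ => True) (fun x y => phi empty_oracle e (pair x y) 1).

Definition index_set (A : str) : nat -> Prop := fun e => bi_embeddable (Ce e) A.

Definition infinite_set (P : nat -> Prop) : Prop :=
  forall n, exists m, n <= m /\ P m.

Definition eq_class (A : str) (x : nat) : nat -> Prop :=
  fun y => dom A y /\ rel A x y.

Definition infinite_class (A : str) (x : nat) : Prop := infinite_set (eq_class A x).

Definition has_k_infinite_classes (A : str) (k : nat) : Prop :=
  exists l : list nat,
    length l = k /\
    (forall x, In x l -> dom A x /\ infinite_class A x) /\
    (forall i j, i < k -> j < k -> rel A (nth i l 0) (nth j l 0) -> i = j) /\
    (forall x, dom A x -> infinite_class A x -> exists y, In y l /\ rel A x y).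

(* Main.v *)
(** Suppose that [A] has exactly [k] infinite classes.  If its finite classes were bounded
    in size, then computable copies would embed computably into each other: match by hand
    the finitely many classes larger than the largest size [p] attained or exceeded
    infinitely often, and send every other class to a fresh class of size at least [p].
    The degree would then be [0], so the finite classes of [A] are unbounded, and a structure
    is bi-embeddable with [A] iff it has exactly [k] infinite classes and unboundedly large
    finite ones.  "At least [k] infinite classes" is Sigma_3 and the rest is Pi_3, even
    though the relation of [Ce e] is only Sigma_1.  For hardness, a Pi_2 event is turned
    into a class that grows each time the event is confirmed; a least-witness (injury)
    argument makes the witness of a Sigma_3 condition unique. *)

Require Import Defs.
From Stdlib Require Import Arith List Lia Bool.
From Stdlib Require Import Classical ClassicalEpsilon.
Import ListNotations.

(** * Pairing *)

(** For hardness the only quantity left to control is the number of infinite classes, and it has to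
    encode a Sigma_3 and a Pi_3 condition at once. With [k - 1] infinite classes built in, a true
    Sigma_3 condition adds exactly one and a failing Pi_3 condition at least two, so the total is
    [k] iff both conditions hold. Several Sigma_3 witnesses with a class each would spoil this
    count, hence the need for uniqueness. In the bounded case, possessing finitely many classes that
    exhaust a given size pulls back along embeddings. The minimal such threshold of the source, less
    one, therefore has infinitely many classes above it in the target, where they can be searched
    for effectively. The classes matched by hand need only a finite table of values of an arbitrary
    embedding, so computability survives. Programs are given by an evaluation relation alone. An
    interpreter acting on numbers supplies the decidable, monotone stages that approximate the
    relation of [Ce e]. *)

Definition triangle (w : nat) : nat := w * (w + 1) / 2.

Lemma triangle_double w : 2 * triangle w = w * (w + 1).
Proof.
  unfold triangle. induction w as [|w IH]; [reflexivity|].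
  replace (S w * (S w + 1)) with (w * (w + 1) + (w + 1) * 2) by lia.
  rewrite Nat.div_add by lia. lia.
Qed.

(** The number under the root is [(2w+1)^2 + 8y], which for [y <= w] stays below [(2w+3)^2]. Its
    root is thus [2w+1] or [2w+2], and both lead to [w]. *)
Lemma unpair_w_spec w y : y <= w -> unpair_w (triangle w + y) = w.
Proof.
  intros Hy. unfold unpair_w.
  pose proof (triangle_double w) as HT.
  set (n := 8 * (triangle w + y) + 1).
  assert (Hn : n = (2 * w + 1) * (2 * w + 1) + 8 * y) by (unfold n; nia).
  destruct (Nat.sqrt_spec' n) as [H1 H2].
  assert (2 * w + 1 <= Nat.sqrt n) by (apply Nat.sqrt_le_square; nia).
  assert (Nat.sqrt n < 2 * w + 3) by (apply Nat.sqrt_lt_square; nia).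
  symmetry. apply Nat.div_unique with (Nat.sqrt n - 1 - 2 * w); lia.
Qed.

Lemma psnd_triangle w y : y <= w -> psnd (triangle w + y) = y.
Proof.
  intros Hy. unfold psnd. rewrite unpair_w_spec by assumption.
  fold (triangle w). lia.
Qed.

Lemma psnd_pair x y : psnd (pair x y) = y.
Proof. apply (psnd_triangle (x + y) y). lia. Qed.

Lemma pfst_pair x y : pfst (pair x y) = x.
Proof.
  unfold pfst. rewrite psnd_pair.
  change (pair x y) with (triangle (x + y) + y).
  rewrite unpair_w_spec by lia. lia.
Qed.

Lemma pair_surjective n : pair (pfst n) (psnd n) = n.
Proof.
  assert (H : exists w y, y <= w /\ n = triangle w + y).
  (* Walking along the diagonals: the successor is the next entry of diagonal [w], or the first
     entry of diagonal [S w]. *)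
  { induction n as [|n (w & y & Hy & ->)]; [exists 0, 0; split; [lia|reflexivity]|].
    destruct (Nat.eq_dec y w) as [->|].
    - exists (S w), 0. split; [lia|].
      pose proof (triangle_double w). pose proof (triangle_double (S w)). nia.
    - exists w, (S y). lia. }
  destruct H as (w & y & Hy & ->).
  replace y with (psnd (pair (w - y) y)) at 1 2 by apply psnd_pair.
  unfold pfst. rewrite psnd_pair, psnd_triangle, unpair_w_spec by assumption.
  change (triangle (w - y + y) + y = triangle w + y).
  now rewrite Nat.sub_add.
Qed.

Lemma pair_inj a b c d : pair a b = pair c d -> a = c /\ b = d.
Proof.
  intros H. split.
  - now rewrite <- (pfst_pair a b), H, pfst_pair.
  - now rewrite <- (psnd_pair a b), H, psnd_pair.
Qed.

Lemma pair_ge a b : a <= pair a b /\ b <= pair a b.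
Proof.
  change (pair a b) with (triangle (a + b) + b).
  pose proof (triangle_double (a + b)). nia.
Qed.

Lemma pfst_le n : pfst n <= n.
Proof. rewrite <- (pair_surjective n) at 2. apply pair_ge. Qed.

Lemma psnd_le n : psnd n <= n.
Proof. rewrite <- (pair_surjective n) at 2. apply pair_ge. Qed.

Global Opaque pair pfst psnd.

(** * Programs and their indices *)

(** Primitive recursion needs an inner induction on the recursion argument. For minimization, the
    smaller of two results would have both a zero and a nonzero value. *)
Lemma ev_deterministic O c : forall x y z, ev O c x y -> ev O c x z -> y = z.
Proof.
  induction c; intros x y z Hy Hz.
  1-6: inversion Hy; inversion Hz; subst; congruence.
  - inversion Hy; inversion Hz; subst.
    assert (y0 = y1) as <- by eauto. eauto.
  - inversion Hy; inversion Hz; subst. f_equal; eauto.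
  - rewrite <- (pair_surjective x) in Hy, Hz.
    revert y z Hy Hz. generalize (pfst x) as u. induction (psnd x) as [|n IH];
      intros u y z Hy Hz; inversion Hy; inversion Hz; subst;
      repeat match goal with H : pair _ _ = pair _ _ |- _ =>
        apply pair_inj in H; destruct H; subst end; try discriminate;
      repeat match goal with H : S _ = S _ |- _ => injection H as H; subst end.
    + eauto.
    + assert (r = r0) as <- by eauto. eauto.
  - inversion Hy as [| | | | | | | | | |f x0 n1 H1 L1]; subst.
    inversion Hz as [| | | | | | | | | |f x0 n2 H2 L2]; subst.
    destruct (Nat.lt_trichotomy y z) as [h|[h|h]]; trivial; exfalso.
    + destruct (L2 _ h) as (v & Hv & E). apply Hv. eauto.
    + destruct (L1 _ h) as (v & Hv & E). apply Hv. eauto.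
Qed.

Fixpoint encode (c : code) : nat :=
  match c with
  | CZero => 0 | CSucc => 1 | CId => 2 | CFst => 3 | CSnd => 4 | COrc => 5
  | CComp g f => pair (encode g) (encode f) * 10 + 6
  | CPair g f => pair (encode g) (encode f) * 10 + 7
  | CPrec g f => pair (encode g) (encode f) * 10 + 8
  | CMu f => encode f * 10 + 9
  end.

Lemma div_mod_10 k r : r < 10 -> (k * 10 + r) / 10 = k /\ (k * 10 + r) mod 10 = r.
Proof.
  intros H. rewrite Nat.add_comm. split.
  - rewrite Nat.div_add, Nat.div_small; lia.
  - rewrite Nat.Div0.mod_add, Nat.mod_small; lia.
Qed.

Lemma decode_S fu n : decode (S fu) n =
    let k := n / 10 in
    match n mod 10 with
    | 0 => CZero | 1 => CSucc | 2 => CId | 3 => CFst | 4 => CSnd | 5 => COrc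
    | 6 => CComp (decode fu (pfst k)) (decode fu (psnd k))
    | 7 => CPair (decode fu (pfst k)) (decode fu (psnd k))
    | 8 => CPrec (decode fu (pfst k)) (decode fu (psnd k))
    | _ => CMu (decode fu k)
    end.
Proof. reflexivity. Qed.

(** The pairing dominates its components, so subprograms have smaller numbers and one unit of fuel
    per level is enough. *)
Lemma decode_encode c : forall fu, encode c < fu -> decode fu (encode c) = c.
Proof.
  induction c; intros [|fu] H; try lia; try reflexivity;
    rewrite decode_S; cbn [encode] in *; cbv zeta;
    match goal with |- context [?k * 10 + ?r] =>
      destruct (div_mod_10 k r) as [-> ->]; [lia|] end;
    rewrite ?pfst_pair, ?psnd_pair;
    try match type of H with context [pair ?a ?b] => pose proof (pair_ge a b) end.
  - rewrite IHc1, IHc2 by lia. reflexivity.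
  - rewrite IHc1, IHc2 by lia. reflexivity.
  - rewrite IHc1, IHc2 by lia. reflexivity.
  - rewrite IHc by lia. reflexivity.
Qed.

Lemma prog_encode c : prog (encode c) = c.
Proof. apply decode_encode. lia. Qed.

Lemma decode_fuel n : forall fu fu', n < fu -> n < fu' -> decode fu n = decode fu' n.
Proof.
  induction n as [n IH] using lt_wf_ind. intros [|fu] [|fu'] H H'; try lia.
  rewrite !decode_S; cbv zeta.
  destruct (Nat.eq_dec n 0) as [->|Hn]; [reflexivity|].
  assert (n / 10 < n) by (apply Nat.div_lt; lia).
  pose proof (pfst_le (n / 10)). pose proof (psnd_le (n / 10)).
  rewrite (IH (pfst (n / 10)) ltac:(lia) fu fu') by lia.
  rewrite (IH (psnd (n / 10)) ltac:(lia) fu fu') by lia.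
  rewrite (IH (n / 10) ltac:(lia) fu fu') by lia.
  reflexivity.
Qed.

(** A recursion equation free of fuel, against which the steps of the universal machine can be
    matched. *)
Lemma prog_unfold n : prog n =
    match n mod 10 with
    | 0 => CZero | 1 => CSucc | 2 => CId | 3 => CFst | 4 => CSnd | 5 => COrc
    | 6 => CComp (prog (pfst (n / 10))) (prog (psnd (n / 10)))
    | 7 => CPair (prog (pfst (n / 10))) (prog (psnd (n / 10)))
    | 8 => CPrec (prog (pfst (n / 10))) (prog (psnd (n / 10)))
    | _ => CMu (prog (n / 10))
    end.
Proof.
  unfold prog at 1. rewrite decode_S. cbv zeta.
  destruct (Nat.eq_dec n 0) as [->|Hn]; [reflexivity|].
  assert (n / 10 < n) by (apply Nat.div_lt; lia).
  pose proof (pfst_le (n / 10)). pose proof (psnd_le (n / 10)).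
  unfold prog.
  rewrite (decode_fuel (pfst (n / 10)) n (S (pfst (n / 10)))) by lia.
  rewrite (decode_fuel (psnd (n / 10)) n (S (psnd (n / 10)))) by lia.
  rewrite (decode_fuel (n / 10) n (S (n / 10))) by lia.
  reflexivity.
Qed.

Global Opaque prog.

(** * Closure properties of the computable functions *)

Lemma computable_iff f :
  computable f <-> exists c, forall x, ev empty_oracle c x (f x).
Proof.
  split.
  - intros [e He]. now exists (prog e).
  - intros [c Hc]. exists (encode c). unfold phi. now rewrite prog_encode.
Qed.

Ltac prim c := apply computable_iff; exists c; intros; econstructor; eauto.

Lemma computable_ext f g : (forall x, f x = g x) -> computable f -> computable g.
Proof. intros E [e He]. exists e. intros x. rewrite <- E. apply He. Qed.

Lemma computable_id : computable (fun x => x).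
Proof. prim CId; constructor. Qed.

Lemma computable_comp g f :
  computable g -> computable f -> computable (fun x => g (f x)).
Proof.
  intros [cg Hg]%computable_iff [cf Hf]%computable_iff. prim (CComp cg cf).
Qed.

Lemma computable_S f : computable f -> computable (fun x => S (f x)).
Proof. apply (computable_comp S). prim CSucc. Qed.

Lemma computable_pfst f : computable f -> computable (fun x => pfst (f x)).
Proof. apply (computable_comp pfst). prim CFst. Qed.

Lemma computable_psnd f : computable f -> computable (fun x => psnd (f x)).
Proof. apply (computable_comp psnd). prim CSnd. Qed.

Lemma computable_const n : computable (fun _ => n).
Proof.
  induction n.
  - prim CZero.
  - now apply (computable_S (fun _ => n)).
Qed.

Lemma computable_pair f g :
  computable f -> computable g -> computable (fun x => pair (f x) (g x)).
Proof.
  intros [cf Hf]%computable_iff [cg Hg]%computable_iff. prim (CPair cf cg).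
Qed.

(** This scheme with a parameter is the source of iteration, case distinction, arithmetic and
    counting; [G] takes its arguments in the packing that [ev_precS] hands to the step program. *)
Lemma computable_nat_rect F (G : nat -> nat -> nat -> nat) K :
  computable F ->
  computable (fun v => G (pfst v) (pfst (psnd v)) (psnd (psnd v))) ->
  computable K ->
  computable (fun x => nat_rect (fun _ => nat) (F x) (G x) (K x)).
Proof.
  intros [cf Hf]%computable_iff [cg Hg]%computable_iff HK.
  assert (H : computable
    (fun v => nat_rect (fun _ => nat) (F (pfst v)) (G (pfst v)) (psnd v))).
  { apply computable_iff. exists (CPrec cf cg). intros v.
    rewrite <- (pair_surjective v) at 1. generalize (pfst v) as x.
    induction (psnd v) as [|n IH]; intros x; cbn.
    - now constructor.
    - econstructor; [apply IH|]. specialize (Hg (pair x (pair n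
        (nat_rect (fun _ => nat) (F x) (G x) n)))).
      now rewrite !psnd_pair, !pfst_pair in Hg. }
  eapply computable_ext, (computable_comp _ (fun x => pair x (K x)) H).
  - intros x. cbn. now rewrite pfst_pair, psnd_pair.
  - apply computable_pair; [apply computable_id|assumption].
Qed.

Ltac computable_step := first
  [ assumption
  | apply computable_const
  | apply computable_id
  | apply computable_pair
  | apply computable_S
  | apply computable_pfst
  | apply computable_psnd ].
Ltac computability := intros; repeat computable_step.

Lemma computable_iter (f : nat -> nat -> nat) g k :
  computable (fun v => f (pfst v) (psnd v)) -> computable g -> computable k ->
  computable (fun x => Nat.iter (k x) (f x) (g x)).
Proof.
  intros Hf Hg Hk. unfold Nat.iter.
  apply (computable_nat_rect g (fun x _ r => f x r) k); trivial.
  apply (computable_ext (fun v => f (pfst (pair (pfst v) (psnd (psnd v))))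
                                    (psnd (pair (pfst v) (psnd (psnd v)))))).
  - intros v. now rewrite pfst_pair, psnd_pair.
  - apply (computable_comp (fun v => f (pfst v) (psnd v))); computability.
Qed.

Lemma computable_if b f g :
  computable_bool b -> computable f -> computable g ->
  computable (fun x => if b x then f x else g x).
Proof.
  intros Hb Hf Hg.
  (* Recursion on the truth value: zero rounds leave [g x], one round replaces it by [f x]. *)
  eapply computable_ext, (computable_nat_rect g (fun x _ _ => f x) _ Hg _ Hb).
  - intros x. cbn. now destruct (b x).
  Unshelve. apply (computable_comp f pfst); computability.
Qed.

Lemma computable_pred f : computable f -> computable (fun x => Nat.pred (f x)).
Proof.
  intros Hf.
  apply (computable_ext (fun x => nat_rect (fun _ => nat) 0 (fun n _ => n) (f x))).
  - intros x. now destruct (f x).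
  - apply (computable_nat_rect _ (fun _ n _ => n)); computability.
Qed.

Lemma computable_add f g :
  computable f -> computable g -> computable (fun x => f x + g x).
Proof.
  intros Hf Hg.
  apply (computable_ext (fun x => Nat.iter (g x) S (f x))).
  - intros x. induction (g x) as [|n IH]; [cbn; lia|]. rewrite Nat.iter_succ, IH. lia.
  - apply (computable_iter (fun _ r => S r)); computability.
Qed.

Lemma computable_mul f g :
  computable f -> computable g -> computable (fun x => f x * g x).
Proof.
  intros Hf Hg.
  apply (computable_ext (fun x => Nat.iter (g x) (fun r => f x + r) 0)).
  - intros x. induction (g x) as [|n IH]; [cbn; lia|]. rewrite Nat.iter_succ, IH. lia.
  - apply (computable_iter (fun x r => f x + r)); computability.
    apply computable_add; computability.
    apply (computable_comp f); computability.
Qed.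

Lemma computable_sub f g :
  computable f -> computable g -> computable (fun x => f x - g x).
Proof.
  intros Hf Hg.
  apply (computable_ext (fun x => Nat.iter (g x) Nat.pred (f x))).
  - intros x. induction (g x) as [|n IH]; [cbn; lia|]. rewrite Nat.iter_succ, IH. lia.
  - apply (computable_iter (fun _ r => Nat.pred r)); computability.
    apply computable_pred; computability.
Qed.

Lemma computable_bool_ext b c :
  (forall x, b x = c x) -> computable_bool b -> computable_bool c.
Proof. intros E. apply computable_ext. intros x. now rewrite E. Qed.

Lemma computable_bool_comp b f :
  computable_bool b -> computable f -> computable_bool (fun x => b (f x)).
Proof. apply (computable_comp (fun x => b2n (b x))). Qed.

Lemma computable_leb f g :
  computable f -> computable g -> computable_bool (fun x => f x <=? g x).
Proof.
  intros Hf Hg. unfold computable_bool.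
  apply (computable_ext (fun x =>
    nat_rect (fun _ => nat) 1 (fun _ _ => 0) (f x - g x))).
  - intros x. destruct (Nat.leb_spec (f x) (g x)) as [H|H].
    + now replace (f x - g x) with 0 by lia.
    + now replace (f x - g x) with (S (f x - g x - 1)) by lia.
  - apply (computable_nat_rect _ (fun _ _ _ => 0)); computability.
    now apply computable_sub.
Qed.

Lemma computable_bool_if b c d :
  computable_bool b -> computable_bool c -> computable_bool d ->
  computable_bool (fun x => if b x then c x else d x).
Proof.
  intros Hb Hc Hd. unfold computable_bool.
  eapply computable_ext, (computable_if b _ _ Hb Hc Hd).
  intros x. cbn. now destruct (b x).
Qed.

Lemma computable_bool_const b : computable_bool (fun _ => b).
Proof. apply (computable_const (b2n b)). Qed.

Lemma computable_negb b :
  computable_bool b -> computable_bool (fun x => negb (b x)).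
Proof. intros. apply (computable_bool_if b (fun _ => false) (fun _ => true));
  trivial using computable_bool_const. Qed.

Lemma computable_andb b c :
  computable_bool b -> computable_bool c -> computable_bool (fun x => b x && c x).
Proof. intros. apply (computable_bool_if b c (fun _ => false));
  trivial using computable_bool_const. Qed.

Lemma computable_orb b c :
  computable_bool b -> computable_bool c -> computable_bool (fun x => b x || c x).
Proof. intros. apply (computable_bool_if b (fun _ => true) c);
  trivial using computable_bool_const. Qed.

Lemma computable_eqb f g :
  computable f -> computable g -> computable_bool (fun x => f x =? g x).
Proof.
  intros Hf Hg.
  apply (computable_bool_ext (fun x => (f x <=? g x) && (g x <=? f x))).
  - intros x. destruct (Nat.eqb_spec (f x) (g x)) as [->|H].
    + now rewrite Nat.leb_refl.
    + apply andb_false_iff. rewrite !Nat.leb_gt. lia.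
  - apply computable_andb; now apply computable_leb.
Qed.

Lemma computable_ltb f g :
  computable f -> computable g -> computable_bool (fun x => f x <? g x).
Proof. intros. apply (computable_leb (fun x => S (f x))); computability. Qed.

Lemma computable_b2n b : computable_bool b -> computable (fun x => b2n (b x)).
Proof. trivial. Qed.

Ltac computable_step ::=
  first [ assumption | lazymatch goal with
  | |- computable (fun _ => ?n) => apply (computable_const n)
  | |- computable (fun x => x) => apply computable_id
  | |- computable (fun x => pair _ _) => apply computable_pair
  | |- computable (fun x => S _) => apply computable_S
  | |- computable pfst => apply (computable_pfst (fun x => x))
  | |- computable psnd => apply (computable_psnd (fun x => x))
  | |- computable (fun x => pfst _) => apply computable_pfst
  | |- computable (fun x => psnd _) => apply computable_psnd
  | |- computable (fun x => Nat.pred _) => apply computable_pred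
  | |- computable (fun x => if _ then _ else _) => apply computable_if
  | |- computable (fun x => _ + _) => apply computable_add
  | |- computable (fun x => _ * _) => apply computable_mul
  | |- computable (fun x => _ - _) => apply computable_sub
  | |- computable (fun x => b2n _) => apply computable_b2n
  | |- computable_bool (fun _ => ?b) => apply (computable_bool_const b)
  | |- computable_bool (fun x => negb _) => apply computable_negb
  | |- computable_bool (fun x => _ && _) => apply computable_andb
  | |- computable_bool (fun x => _ || _) => apply computable_orb
  | |- computable_bool (fun x => _ =? _) => apply computable_eqb
  | |- computable_bool (fun x => _ <=? _) => apply computable_leb
  | |- computable_bool (fun x => _ <? _) => apply computable_ltb
  | |- computable_bool (fun x => if _ then _ else _) => apply computable_bool_if
  end ].

Lemma computable_div_mod_10 f :
  computable f -> computable (fun x => f x / 10) /\ computable (fun x => f x mod 10).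
Proof.
  intros Hf.
  (* A counter run [n] times on the pair of quotient and remainder, with carry at 9. *)
  set (D n := Nat.iter n (fun r =>
    if psnd r =? 9 then pair (S (pfst r)) 0 else pair (pfst r) (S (psnd r))) (pair 0 0)).
  assert (HD : forall n, D n = pair (n / 10) (n mod 10)).
  { induction n as [|n IH]; [reflexivity|].
    unfold D in *. rewrite Nat.iter_succ, IH, pfst_pair, psnd_pair.
    pose proof (Nat.div_mod_eq n 10). pose proof (Nat.mod_upper_bound n 10 ltac:(lia)).
    destruct (Nat.eqb_spec (n mod 10) 9) as [E|E]; f_equal.
    - apply Nat.div_unique with 0; lia.
    - apply Nat.mod_unique with (S (n / 10)); lia.
    - apply Nat.div_unique with (S (n mod 10)); lia.
    - apply Nat.mod_unique with (n / 10); lia. }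
  assert (H : computable (fun x => D (f x))).
  { apply (computable_iter (fun _ r => if psnd r =? 9 then pair (S (pfst r)) 0
                                       else pair (pfst r) (S (psnd r)))); computability. }
  split.
  - eapply computable_ext, (computable_pfst _ H). intros x. cbn. now rewrite HD, pfst_pair.
  - eapply computable_ext, (computable_psnd _ H). intros x. cbn. now rewrite HD, psnd_pair.
Qed.

Lemma computable_comp2 (h : nat -> nat -> nat) f g :
  computable (fun v => h (pfst v) (psnd v)) -> computable f -> computable g ->
  computable (fun x => h (f x) (g x)).
Proof.
  intros Hh Hf Hg.
  eapply computable_ext, (computable_comp _ (fun x => pair (f x) (g x)) Hh).
  - intros x. cbn. now rewrite pfst_pair, psnd_pair.
  - computability.
Qed.

Lemma computable_bool_comp2 (h : nat -> nat -> bool) f g :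
  computable_bool (fun v => h (pfst v) (psnd v)) -> computable f -> computable g ->
  computable_bool (fun x => h (f x) (g x)).
Proof. apply (computable_comp2 (fun a b => b2n (h a b))). Qed.

Definition count (p : nat -> bool) (s : nat) : nat := length (filter p (seq 0 s)).

Lemma count_S p s : count p (S s) = count p s + b2n (p s).
Proof.
  unfold count. rewrite seq_S, filter_app, length_app. cbn. now destruct (p s).
Qed.

Lemma computable_count (p : nat -> nat -> bool) f :
  computable_bool (fun v => p (pfst v) (psnd v)) -> computable f ->
  computable (fun x => count (p x) (f x)).
Proof.
  intros Hp Hf.
  apply (computable_ext (fun x =>
    nat_rect (fun _ => nat) 0 (fun n r => r + b2n (p x n)) (f x))).
  - intros x. induction (f x) as [|n IH]; [reflexivity|].
    now rewrite count_S, <- IH.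
  - apply (computable_nat_rect _ (fun x n r => r + b2n (p x n))); computability.
    apply (computable_bool_comp2 p); computability.
Qed.

Lemma least_witness (P : nat -> Prop) :
  (exists n, P n) -> exists n, P n /\ forall m, m < n -> ~ P m.
Proof.
  intros [n Hn]. induction n as [n IH] using lt_wf_ind.
  destruct (classic (exists m, m < n /\ P m)) as [(m & Hm & Pm)|H].
  - eauto.
  - exists n. split; trivial. intros m Hm Pm. eauto.
Qed.

Lemma choice (P : nat -> nat -> Prop) :
  (forall x, exists y, P x y) -> exists f, forall x, P x (f x).
Proof.
  intros H. exists (fun x => proj1_sig (constructive_indefinite_description _ (H x))).
  intros x. now destruct (constructive_indefinite_description _ (H x)).
Qed.

Lemma computable_search (p : nat -> nat -> bool) :
  computable_bool (fun v => p (pfst v) (psnd v)) ->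
  (forall x, exists n, p x n = true) ->
  exists f, computable f /\ forall x, p x (f x) = true.
Proof.
  intros Hp Hex.
  destruct (choice (fun x n => p x n = true /\ forall m, m < n -> p x m <> true))
    as [f Hf].
  { intros x. apply least_witness, Hex. }
  exists f. split; [|apply Hf].
  (* [CMu] looks for the value 0, so the predicate is negated first. *)
  apply computable_negb, computable_iff in Hp as [c Hc].
  assert (Hc' : forall x n, ev empty_oracle c (pair x n) (b2n (negb (p x n)))).
  { intros x n. specialize (Hc (pair x n)). now rewrite pfst_pair, psnd_pair in Hc. }
  apply computable_iff. exists (CMu c). intros x. destruct (Hf x) as [H1 H2].
  constructor.
  - specialize (Hc' x (f x)). now rewrite H1 in Hc'.
  - intros m Hm. exists 1. split; [lia|]. specialize (Hc' x m).
    apply H2, not_true_is_false in Hm. now rewrite Hm in Hc'.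
Qed.

(** * A universal stack machine *)

(* A state is [eval_state e x K] (run program [e] on [x], then the stack [K]) or
   [ret_state v K] (return [v] to [K]).  A frame is a tagged pair: 0 = pending outer
   program of [CComp]; 1, 2 = pending second, known first component of [CPair];
   3 = pending step of [CPrec]; 4 = candidate of [CMu]. *)
Definition eval_state (e x K : nat) : nat := pair 0 (pair e (pair x K)).
Definition ret_state (v K : nat) : nat := pair 1 (pair v K).
Definition push (tag a K : nat) : nat := S (pair (pair tag a) K).

Definition step_eval (e x K : nat) : nat :=
  if e mod 10 =? 0 then ret_state 0 K
  else if e mod 10 =? 1 then ret_state (S x) K
  else if e mod 10 =? 2 then ret_state x K
  else if e mod 10 =? 3 then ret_state (pfst x) K
  else if e mod 10 =? 4 then ret_state (psnd x) K
  (* The simulated oracle is the empty one, which always answers 0. *)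
  else if e mod 10 =? 5 then ret_state 0 K
  else if e mod 10 =? 6 then
    eval_state (psnd (e / 10)) x (push 0 (pfst (e / 10)) K)
  else if e mod 10 =? 7 then
    eval_state (pfst (e / 10)) x (push 1 (pair (psnd (e / 10)) x) K)
  else if e mod 10 =? 8 then
    if psnd x =? 0 then eval_state (pfst (e / 10)) (pfst x) K
    else eval_state e (pair (pfst x) (Nat.pred (psnd x)))
           (push 3 (pair (psnd (e / 10)) (pair (pfst x) (Nat.pred (psnd x)))) K)
  else eval_state (e / 10) (pair x 0) (push 4 (pair (e / 10) (pair x 0)) K).

Definition step_frame (v tag a K : nat) : nat :=
  if tag =? 0 then eval_state a v K
  else if tag =? 1 then eval_state (pfst a) (psnd a) (push 2 v K)
  else if tag =? 2 then ret_state (pair a v) K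
  else if tag =? 3 then
    eval_state (pfst a) (pair (pfst (psnd a)) (pair (psnd (psnd a)) v)) K
  else if v =? 0 then ret_state (psnd (psnd a)) K
  else eval_state (pfst a) (pair (pfst (psnd a)) (S (psnd (psnd a))))
         (push 4 (pair (pfst a) (pair (pfst (psnd a)) (S (psnd (psnd a))))) K).

(** Pushed stacks are successors, so 0 is the empty stack, and returning to it is a fixed point of
    [step]: a halted run stays halted. *)
Definition step_ret (v K : nat) : nat :=
  if K =? 0 then ret_state v K
  else step_frame v (pfst (pfst (Nat.pred K))) (psnd (pfst (Nat.pred K)))
         (psnd (Nat.pred K)).

Definition step (s : nat) : nat :=
  if pfst s =? 0 then
    step_eval (pfst (psnd s)) (pfst (psnd (psnd s))) (psnd (psnd (psnd s)))
  else step_ret (pfst (psnd s)) (psnd (psnd s)).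

Lemma computable_step_fun : computable step.
Proof.
  assert (H1 : forall f, computable f -> computable (fun x => f x / 10))
    by (intros; now apply computable_div_mod_10).
  assert (H2 : forall f, computable f -> computable (fun x => f x mod 10))
    by (intros; now apply computable_div_mod_10).
  unfold step, step_eval, step_ret, step_frame, eval_state, ret_state, push.
  repeat first [computable_step | apply H1 | apply H2].
Qed.

Ltac unpair := repeat first [rewrite pfst_pair | rewrite psnd_pair].

Lemma step_eval_state e x K : step (eval_state e x K) = step_eval e x K.
Proof. unfold step, eval_state. now unpair. Qed.

Lemma step_ret_state v K : step (ret_state v K) = step_ret v K.
Proof. unfold step, ret_state. now unpair. Qed.

Lemma step_halted v : step (ret_state v 0) = ret_state v 0.
Proof. now rewrite step_ret_state. Qed.

Lemma step_push v tag a K : step (ret_state v (push tag a K)) = step_frame v tag a K.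
Proof.
  rewrite step_ret_state. unfold step_ret, push. cbn [Nat.eqb Nat.pred].
  now unpair.
Qed.

Definition reaches (s t : nat) : Prop := exists n, Nat.iter n step s = t.

Lemma reaches_refl s : reaches s s.
Proof. now exists 0. Qed.

Lemma reaches_step s t : reaches (step s) t -> reaches s t.
Proof. intros [n Hn]. exists (S n). now rewrite Nat.iter_succ_r. Qed.

Lemma reaches_trans s t u : reaches s t -> reaches t u -> reaches s u.
Proof.
  intros [n <-] [m <-]. exists (m + n). apply Nat.iter_add.
Qed.

Lemma step_eval_prec e x n K : e mod 10 = 8 ->
  step (eval_state e (pair x n) K) =
  match n with
  | 0 => eval_state (pfst (e / 10)) x K
  | S n => eval_state e (pair x n) (push 3 (pair (psnd (e / 10)) (pair x n)) K)
  end.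
Proof.
  intros E. rewrite step_eval_state. unfold step_eval. rewrite E. cbn [Nat.eqb].
  rewrite psnd_pair, pfst_pair. now destruct n.
Qed.

Ltac machine := rewrite ?step_eval_state, ?step_push; unfold step_eval, step_frame;
  repeat match goal with E : _ mod 10 = _ |- _ => rewrite E end;
  cbn [Nat.eqb]; unpair.

Lemma mod_10_cases e :
  e mod 10 = 0 \/ e mod 10 = 1 \/ e mod 10 = 2 \/ e mod 10 = 3 \/ e mod 10 = 4 \/
  e mod 10 = 5 \/ e mod 10 = 6 \/ e mod 10 = 7 \/ e mod 10 = 8 \/ e mod 10 = 9.
Proof. pose proof (Nat.mod_upper_bound e 10 ltac:(lia)). lia. Qed.

Lemma index_children e : e mod 10 <> 0 ->
  e / 10 < e /\ pfst (e / 10) < e /\ psnd (e / 10) < e.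
Proof.
  intros H. assert (e <> 0) by (intros ->; now apply H).
  assert (e / 10 < e) by (apply Nat.div_lt; lia).
  pose proof (pfst_le (e / 10)). pose proof (psnd_le (e / 10)). lia.
Qed.

(** Completeness of the machine, by induction on the index, since subprograms have smaller indices.
    Primitive recursion calls the same index again and needs an inner induction. *)
Lemma ev_reaches e : forall x v K, ev empty_oracle (prog e) x v ->
  reaches (eval_state e x K) (ret_state v K).
Proof.
  induction e as [e IH] using lt_wf_ind. intros x v K H.
  pose proof (index_children e) as Hlt.
  pose proof (prog_unfold e) as Hp.
  destruct (mod_10_cases e) as [E|[E|[E|[E|[E|[E|[E|[E|[E|E]]]]]]]]];
    rewrite E in Hp, Hlt; specialize (Hlt ltac:(discriminate)) || clear Hlt;
    rewrite Hp in H.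
  1-6: apply reaches_step; machine; inversion H; apply reaches_refl.
  - inversion H; subst. apply reaches_step; machine.
    eapply reaches_trans; [eapply IH; eauto; lia|].
    apply reaches_step; machine. eapply IH; eauto; lia.
  - inversion H; subst. apply reaches_step; machine.
    eapply reaches_trans; [eapply IH; eauto; lia|].
    apply reaches_step; machine.
    eapply reaches_trans; [eapply IH; eauto; lia|].
    apply reaches_step; machine. apply reaches_refl.
  - rewrite <- (pair_surjective x) in *. revert v K H. generalize (pfst x) as u.
    induction (psnd x) as [|n IHn]; intros u v K H; apply reaches_step;
      rewrite step_eval_prec by assumption; inversion H; subst;
      repeat match goal with H : pair _ _ = pair _ _ |- _ =>
        apply pair_inj in H; destruct H; subst end; try discriminate;
      repeat match goal with H : S _ = S _ |- _ => injection H as H; subst end.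
    + eapply IH; eauto; lia.
    + eapply reaches_trans; [eapply IHn; eauto|].
      apply reaches_step; machine. eapply IH; eauto; lia.
  - inversion H as [| | | | | | | | | |f x0 n H0 Hm]; subst.
    apply reaches_step; machine.
    assert (Hgo : forall m, m <= v -> reaches
      (eval_state (e / 10) (pair x 0) (push 4 (pair (e / 10) (pair x 0)) K))
      (eval_state (e / 10) (pair x m) (push 4 (pair (e / 10) (pair x m)) K))).
    { induction m as [|m IHm]; intros Hle; [apply reaches_refl|].
      eapply reaches_trans; [apply IHm; lia|].
      destruct (Hm m Hle) as (w & Hw & Ew).
      eapply reaches_trans; [eapply IH; eauto; lia|].
      apply reaches_step; machine. destruct w; [easy|]. apply reaches_refl. }
    eapply reaches_trans; [apply (Hgo v); lia|].
    eapply reaches_trans; [eapply IH; eauto; lia|].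
    apply reaches_step; machine. apply reaches_refl.
Qed.

Definition halts_within (n v s : nat) : Prop := Nat.iter n step s = ret_state v 0.

Lemma halts_within_eval n v e x K : halts_within n v (eval_state e x K) ->
  exists m, n = S m /\ halts_within m v (step (eval_state e x K)).
Proof.
  unfold halts_within. destruct n as [|n]; intros H.
  - apply pair_inj in H as [H _]. discriminate.
  - exists n. now rewrite <- Nat.iter_succ_r.
Qed.

Lemma halts_within_push n v w t a K : halts_within n v (ret_state w (push t a K)) ->
  exists m, n = S m /\ halts_within m v (step (ret_state w (push t a K))).
Proof.
  unfold halts_within. destruct n as [|n]; intros H.
  - apply pair_inj in H as [_ H]. apply pair_inj in H as [_ H]. discriminate.
  - exists n. now rewrite <- Nat.iter_succ_r.
Qed.

Ltac machine_in H := rewrite ?step_eval_state, ?step_push in H;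
  unfold step_eval, step_frame in H;
  repeat match goal with E : _ mod 10 = _ |- _ => rewrite E in H end;
  cbn [Nat.eqb] in H;
  repeat first [rewrite pfst_pair in H | rewrite psnd_pair in H].

(** Soundness of the machine, by induction on the step count: before a run can halt, control must
    return a correct value to [K], with fewer steps left. Arbitrary [K] makes this applicable to
    nested calls. *)
Lemma halts_within_ev n : forall v e x K, halts_within n v (eval_state e x K) ->
  exists m w, m < n /\ ev empty_oracle (prog e) x w /\ halts_within m v (ret_state w K).
Proof.
  induction n as [n IH] using lt_wf_ind. intros v e x K H.
  destruct (halts_within_eval _ _ _ _ _ H) as (m & -> & H1).
  pose proof (prog_unfold e) as Hp.
  destruct (mod_10_cases e) as [E|[E|[E|[E|[E|[E|[E|[E|[E|E]]]]]]]]];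
    rewrite E in Hp; rewrite Hp.
  1-6: machine_in H1; do 2 eexists; split; [|split; [|exact H1]]; [lia|constructor].
  - machine_in H1. apply IH in H1 as (m1 & w1 & Hm1 & E1 & H1); [|lia].
    apply halts_within_push in H1 as (m2 & -> & H1). machine_in H1.
    apply IH in H1 as (m3 & w2 & Hm3 & E2 & H1); [|lia].
    exists m3, w2. repeat split; trivial; [lia|]. econstructor; eauto.
  - machine_in H1. apply IH in H1 as (m1 & w1 & Hm1 & E1 & H1); [|lia].
    apply halts_within_push in H1 as (m2 & -> & H1). machine_in H1.
    apply IH in H1 as (m3 & w2 & Hm3 & E2 & H1); [|lia].
    apply halts_within_push in H1 as (m4 & -> & H1). machine_in H1.
    exists m4, (pair w1 w2). repeat split; trivial; [lia|]. constructor; eauto.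
  - rewrite <- (pair_surjective x) in H1 |- *. rewrite step_eval_prec in H1 by assumption.
    destruct (psnd x) as [|k].
    + apply IH in H1 as (m1 & w1 & Hm1 & E1 & H1); [|lia].
      exists m1, w1. repeat split; trivial; [lia|]. now constructor.
    + apply IH in H1 as (m1 & w1 & Hm1 & E1 & H1); [|lia].
      apply halts_within_push in H1 as (m2 & -> & H1). machine_in H1.
      apply IH in H1 as (m3 & w2 & Hm3 & E2 & H1); [|lia].
      exists m3, w2. repeat split; trivial; [lia|]. rewrite Hp in E1.
      econstructor; eauto.
  - machine_in H1.
    (* The search loop, entered at an arbitrary candidate [k] whose predecessors are known to give
       nonzero values. *)
    assert (Hgo : forall n' k, n' <= m -> (forall j, j < k -> exists u, u <> 0 /\
        ev empty_oracle (prog (e / 10)) (pair x j) u) ->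
      halts_within n' v (eval_state (e / 10) (pair x k)
        (push 4 (pair (e / 10) (pair x k)) K)) ->
      exists m w, m < n' /\ ev empty_oracle (CMu (prog (e / 10))) x w /\
        halts_within m v (ret_state w K)).
    { induction n' as [n' IHn] using lt_wf_ind. intros k Hle Hk H2.
      apply IH in H2 as (m1 & w1 & Hm1 & E1 & H2); [|lia].
      apply halts_within_push in H2 as (m2 & -> & H2). machine_in H2.
      destruct w1 as [|w1].
      - exists m2, k. repeat split; trivial; [lia|]. now constructor.
      - apply (IHn m2 ltac:(lia) (S k)) in H2 as (m3 & w & Hm3 & E2 & H2); [|lia|].
        + exists m3, w. repeat split; trivial; lia.
        + intros j Hj. destruct (Nat.eq_dec j k) as [->|]; [|apply Hk; lia].
          now exists (S w1). }
    apply Hgo in H1 as (m1 & w & Hm & E1 & H1); [|lia|intros; lia].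
    exists m1, w. repeat split; trivial. lia.
Qed.

(** The decidable stage-[s] approximation to acceptance, that is, to halting with output 1. *)
Definition accepts_by (s e x : nat) : bool :=
  Nat.iter s step (eval_state e x 0) =? ret_state 1 0.

Lemma accepts_by_spec e x :
  phi empty_oracle e x 1 <-> exists s, accepts_by s e x = true.
Proof.
  unfold phi, accepts_by. setoid_rewrite Nat.eqb_eq. split.
  - apply ev_reaches.
  - intros [s Hs]. apply halts_within_ev in Hs as (m & w & _ & E & H).
    assert (Hw : Nat.iter m step (ret_state w 0) = ret_state w 0).
    { clear H. induction m as [|m IH]; [reflexivity|].
      rewrite Nat.iter_succ, IH. apply step_halted. }
    unfold halts_within in H. rewrite Hw in H.
    apply pair_inj in H as [_ H]. apply pair_inj in H as [-> _]. exact E.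
Qed.

Lemma accepts_by_mono s t e x :
  s <= t -> accepts_by s e x = true -> accepts_by t e x = true.
Proof.
  unfold accepts_by. rewrite !Nat.eqb_eq. intros Hle H.
  induction Hle; [assumption|]. rewrite Nat.iter_succ, IHHle. apply step_halted.
Qed.

Lemma computable_accepts_by s e x :
  computable s -> computable e -> computable x ->
  computable_bool (fun n => accepts_by (s n) (e n) (x n)).
Proof.
  intros Hs He Hx. apply computable_eqb; [|computability].
  apply (computable_iter (fun _ r => step r)); trivial.
  - apply (computable_comp step); [apply computable_step_fun|computability].
  - unfold eval_state. computability.
Qed.

(** * The arithmetical hierarchy *)

(* [arith true n] is Sigma_n and [arith false n] is Pi_n. *)
Fixpoint arith (b : bool) (n : nat) (P : nat -> Prop) : Prop :=
  match n with
  | 0 => exists R, computable_bool R /\ forall x, P x <-> R x = true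
  | S n => exists Q, arith (negb b) n Q /\ forall x, P x <->
      if b then exists y, Q (pair x y) else forall y, Q (pair x y)
  end.

Lemma arith_ext b n P Q : (forall x, P x <-> Q x) -> arith b n P -> arith b n Q.
Proof.
  intros E. destruct n; intros (R & HR & H); exists R; split; trivial;
    intros x; rewrite <- E; apply H.
Qed.

Lemma arith_comp b n P f :
  arith b n P -> computable f -> arith b n (fun x => P (f x)).
Proof.
  intros HP Hf. revert b P f HP Hf. induction n as [|n IH]; intros b P f (R & HR & H) Hf.
  - exists (fun x => R (f x)). split; [now apply computable_bool_comp|].
    intros x. apply H.
  - exists (fun v => R (pair (f (pfst v)) (psnd v))). split.
    + apply IH; trivial. computability. apply (computable_comp f); computability.
    + intros x. rewrite H. destruct b; setoid_rewrite pfst_pair;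
        setoid_rewrite psnd_pair; reflexivity.
Qed.

Lemma arith_not b n P : arith b n P -> arith (negb b) n (fun x => ~ P x).
Proof.
  revert b P. induction n as [|n IH]; intros b P (R & HR & H).
  - exists (fun x => negb (R x)). split; [computability|].
    intros x. rewrite H. now destruct (R x).
  - exists (fun x => ~ R x). split; [now apply IH|].
    intros x. rewrite H. destruct b; cbn; split; intros H1.
    + intros y Hy. apply H1. eauto.
    + intros [y Hy]. now apply (H1 y).
    + now apply not_all_ex_not.
    + intros H2. destruct H1 as [y Hy]. now apply Hy.
Qed.

Lemma arith_and b n P Q : arith b n P -> arith b n Q -> arith b n (fun x => P x /\ Q x).
Proof.
  revert b P Q. induction n as [|n IH]; intros b P Q (R & HR & H) (R' & HR' & H').
  - exists (fun x => R x && R' x). split; [computability|].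
    intros x. now rewrite H, H', andb_true_iff.
  (* Two existential witnesses have to share one variable as a pair; a universal variable serves
     both conjuncts as it is. *)
  - exists (fun v => R (if b then pair (pfst v) (pfst (psnd v)) else v) /\
                     R' (if b then pair (pfst v) (psnd (psnd v)) else v)). split.
    + apply IH; apply arith_comp; trivial; destruct b; computability.
    + intros x. rewrite H, H'. destruct b; split.
      * intros [[y Hy] [z Hz]]. exists (pair y z). now unpair.
      * intros [y [H1 H2]]. rewrite psnd_pair, pfst_pair in *. eauto.
      * intros [H1 H2] y. now split.
      * intros H1. split; intros y; apply (H1 y).
Qed.

Lemma arith_or b n P Q : arith b n P -> arith b n Q -> arith b n (fun x => P x \/ Q x).
Proof.
  intros HP HQ. rewrite <- (negb_involutive b).
  eapply arith_ext, arith_not, arith_and; [|apply arith_not, HP|apply arith_not, HQ].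
  intros x. cbn. split; [|tauto]. intros H. apply NNPP. tauto.
Qed.

(** A dummy quantifier goes in front when the leading quantifiers differ; when they agree, the
    leading one is kept and the matrix is lifted. *)
Lemma arith_lift b b' n P : arith b n P -> arith b' (S n) P.
Proof.
  revert b b' P. induction n as [|n IH]; intros b b' P HP.
  - exists (fun v => P (pfst v)). split.
    + destruct HP as (R & HR & H). exists (fun v => R (pfst v)). split.
      * apply computable_bool_comp; computability.
      * intros x. apply H.
    + intros x. assert (forall y, P (pfst (pair x y)) <-> P x)
        by (intros; now rewrite pfst_pair). destruct b'; firstorder (exact 0).
  - destruct (bool_dec b b') as [->|Hb].
    + destruct HP as (R & HR & H). exists R. split; trivial. eapply IH, HR.
    + replace b with (negb b') in HP by now destruct b, b'.
      exists (fun v => P (pfst v)). split.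
      * apply arith_comp; computability.
      * intros x. assert (forall y, P (pfst (pair x y)) <-> P x)
          by (intros; now rewrite pfst_pair). destruct b'; firstorder (exact 0).
Qed.

Lemma arith_le b n m P : n <= m -> arith b n P -> arith b m P.
Proof. induction 1; trivial. intros. eapply arith_lift. eauto. Qed.

Lemma arith_exists n P :
  arith true (S n) (fun v => P (pfst v) (psnd v)) ->
  arith true (S n) (fun x => exists y, P x y).
Proof.
  intros (R & HR & H). exists (fun v => R (pair (pair (pfst v) (pfst (psnd v)))
                                               (psnd (psnd v)))). split.
  - apply (arith_comp (negb true) n R); trivial. computability.
  - intros x. split.
    + intros [y Hy]. specialize (H (pair x y)). rewrite pfst_pair, psnd_pair in H.
      apply H in Hy as [z Hz]. exists (pair y z). now unpair.
    + intros [z Hz]. exists (pfst z). specialize (H (pair x (pfst z))).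
      rewrite pfst_pair, psnd_pair in *. apply H. eauto.
Qed.

Lemma arith_forall n P :
  arith false (S n) (fun v => P (pfst v) (psnd v)) ->
  arith false (S n) (fun x => forall y, P x y).
Proof.
  intros HP. apply arith_not in HP.
  apply (arith_exists n (fun x y => ~ P x y)), arith_not in HP.
  eapply arith_ext, HP. intros x. cbn. split; [|firstorder].
  intros H y. apply NNPP. eauto.
Qed.

Lemma arith_const b n (P : Prop) : arith b n (fun _ => P).
Proof.
  apply (arith_le b 0); [lia|]. destruct (classic P).
  - exists (fun _ => true). split; [computability|tauto].
  - exists (fun _ => false). split; [computability|]. now intuition.
Qed.

Lemma arith_bool b n r : computable_bool r -> arith b n (fun x => r x = true).
Proof.
  intros H. apply (arith_le b 0); [lia|]. now exists r.
Qed.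

Lemma arith_forall_lt b n k (P : nat -> nat -> Prop) :
  (forall i, i < k -> arith b n (P i)) -> arith b n (fun x => forall i, i < k -> P i x).
Proof.
  induction k as [|k IH]; intros H.
  - eapply arith_ext, (arith_const b n True). intros x. split; [lia|trivial].
  - eapply arith_ext, arith_and; [|apply IH; auto|apply (H k); auto].
    intros x. cbn. split.
    + intros [H1 H2] i Hi. destruct (Nat.eq_dec i k) as [->|]; auto with arith. apply H1; lia.
    + auto.
Qed.

(** Unfolding [arith] nests pairs to the left, while [Sigma3] and [Pi3] nest them to the right; this
    repacks one into the other. *)
Lemma arith_3_normal_form b P : arith b 3 P <->
  exists R, computable_bool R /\ forall x, P x <->
    if b then exists a, forall c, exists d, R (pair x (pair a (pair c d))) = true
    else forall a, exists c, forall d, R (pair x (pair a (pair c d))) = true.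
Proof.
  split.
  - intros (Q & (Q' & (Q'' & (R & HR & H0) & H1) & H2) & H3).
    exists (fun v => R (pair (pair (pair (pfst v) (pfst (psnd v)))
      (pfst (psnd (psnd v)))) (psnd (psnd (psnd v))))). split.
    + apply (computable_bool_comp R); computability.
    + assert (H : forall x a c d,
        R (pair (pair (pair (pfst (pair x (pair a (pair c d))))
          (pfst (psnd (pair x (pair a (pair c d))))))
          (pfst (psnd (psnd (pair x (pair a (pair c d)))))))
          (psnd (psnd (psnd (pair x (pair a (pair c d))))))) = true <->
        Q'' (pair (pair (pair x a) c) d)) by (intros; unpair; now rewrite H0).
      intros x. rewrite H3. destruct b; cbn in *; setoid_rewrite H2; setoid_rewrite H1;
        setoid_rewrite H; reflexivity.
  - intros (R & HR & H). eapply arith_ext; [intros x; symmetry; apply H|]. clear H.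
    destruct b.
    + apply arith_exists, (arith_lift false), arith_forall, (arith_lift true),
        arith_exists, arith_bool, (computable_bool_comp R); computability.
    + apply arith_forall, (arith_lift true), arith_exists, (arith_lift false),
        arith_forall, arith_bool, (computable_bool_comp R); computability.
Qed.

Lemma Sigma3_arith P : Sigma3 P <-> arith true 3 P.
Proof. symmetry. apply arith_3_normal_form. Qed.

Lemma Pi3_arith P : Pi3 P <-> arith false 3 P.
Proof. symmetry. apply arith_3_normal_form. Qed.

Lemma arith_phi e x :
  computable e -> computable x -> arith true 1 (fun v => phi empty_oracle (e v) (x v) 1).
Proof.
  intros He Hx.
  apply (arith_ext _ _ (fun v => exists s, accepts_by s (e v) (x v) = true)).
  - intros v. symmetry. apply accepts_by_spec.
  - apply arith_exists, arith_bool, computable_accepts_by; computability.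
    + now apply (computable_comp e); computability.
    + now apply (computable_comp x); computability.
Qed.

(** * Counting and class sizes *)

Lemma count_mono p s t : s <= t -> count p s <= count p t.
Proof. induction 1; trivial. rewrite count_S. lia. Qed.

(** [count p x] is the rank of [x] in the set [p], and the rank increases strictly past each
    member. *)
Lemma count_inj p x y : p x = true -> p y = true -> count p x = count p y -> x = y.
Proof.
  assert (H : forall x y, x < y -> p x = true -> count p x < count p y).
  { intros u v Hlt Hu. pose proof (count_mono p (S u) v Hlt) as H.
    rewrite count_S, Hu in H. cbn in H. lia. }
  intros Hx Hy E. destruct (Nat.lt_trichotomy x y) as [h|[h|h]]; trivial.
  - specialize (H _ _ h Hx). lia.
  - specialize (H _ _ h Hy). lia.
Qed.

Lemma count_ext p q s : (forall x, p x = q x) -> count p s = count q s.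
Proof. intros E. induction s; [reflexivity|]. now rewrite !count_S, E, IHs. Qed.

Lemma count_hit p s j : j < count p s -> exists z, p z = true /\ count p z = j.
Proof.
  induction s as [|s IH]; [cbn; lia|]. rewrite count_S. intros H.
  destruct (le_lt_dec (count p s) j); [|auto].
  destruct (p s) eqn:E; cbn in H; [exists s; split; trivial|]; lia.
Qed.

Definition size_ge (S : str) (x N : nat) : Prop :=
  exists l, NoDup l /\ N <= length l /\ forall y, In y l -> eq_class S x y.

Definition decides (S : str) (d : nat -> bool) (r : nat -> nat -> bool) : Prop :=
  (forall x, dom S x <-> d x = true) /\ (forall x y, rel S x y <-> r x y = true).

Definition member (d : nat -> bool) (r : nat -> nat -> bool) (x y : nat) : bool :=
  d y && r x y.

(** Classical deciders let one construction yield arbitrary embeddings as well as computable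
    ones. *)
Lemma decides_exists S : exists d r, decides S d r.
Proof.
  exists (fun x => if excluded_middle_informative (dom S x) then true else false),
    (fun x y => if excluded_middle_informative (rel S x y) then true else false).
  split; intros; now destruct excluded_middle_informative.
Qed.

Lemma member_spec S d r : decides S d r ->
  forall x y, eq_class S x y <-> member d r x y = true.
Proof.
  intros [Hd Hr] x y. unfold eq_class, member. now rewrite Hd, Hr, andb_true_iff.
Qed.

Lemma list_bound (l : list nat) : exists b, forall x, In x l -> x < b.
Proof.
  induction l as [|a l [b Hb]]; [now exists 0|].
  exists (Nat.max b (S a)). intros x [->|H]; [|specialize (Hb _ H)]; lia.
Qed.

Lemma count_ge_NoDup p N s : N <= count p s ->
  exists l, NoDup l /\ N <= length l /\ forall y, In y l -> p y = true.
Proof.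
  intros H. exists (filter p (seq 0 s)). repeat split; trivial.
  - apply NoDup_filter, seq_NoDup.
  - intros y Hy. now apply filter_In in Hy.
Qed.

Lemma NoDup_count_ge p l s : NoDup l -> (forall y, In y l -> y < s /\ p y = true) ->
  length l <= count p s.
Proof.
  intros Hl H. apply NoDup_incl_length; trivial. intros y Hy.
  apply filter_In. destruct (H y Hy). split; trivial. apply in_seq. lia.
Qed.

Lemma size_ge_count S d r x N : decides S d r ->
  size_ge S x N <-> exists s, N <= count (member d r x) s.
Proof.
  intros HD. pose proof (member_spec _ _ _ HD x) as Hm. split.
  - intros (l & Hl & HN & H). destruct (list_bound l) as [b Hb]. exists b.
    etransitivity; [apply HN|]. apply NoDup_count_ge; trivial.
    intros y Hy. rewrite <- Hm. auto.
  - intros [s Hs]. destruct (count_ge_NoDup _ _ _ Hs) as (l & H1 & H2 & H3).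
    exists l. repeat split; trivial; apply Hm, H3, H.
Qed.

Lemma size_ge_le S x N M : N <= M -> size_ge S x M -> size_ge S x N.
Proof. intros H (l & H1 & H2 & H3). exists l. repeat split; trivial; [lia| |]; now apply H3. Qed.

Lemma infinite_class_size S x : infinite_class S x <-> forall N, size_ge S x N.
Proof.
  split.
  - intros H. induction N as [|N (l & H1 & H2 & H3)].
    + exists nil. repeat split; [constructor|trivial| |]; contradiction.
    + destruct (list_bound l) as [b Hb]. destruct (H b) as (m & Hm & Hx).
      exists (m :: l). split; [|split].
      * constructor; trivial. intros Hin. specialize (Hb _ Hin). lia.
      * cbn. lia.
      * intros y [<-|Hy]; auto.
  - intros H n. destruct (H (1 + n)) as (l & H1 & H2 & H3). apply NNPP. intros Hn.
    assert (length l <= length (seq 0 n)).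
    { apply NoDup_incl_length; trivial. intros y Hy. apply in_seq.
      destruct (le_lt_dec n y); [|lia]. exfalso. eauto. }
    rewrite length_seq in *. lia.
Qed.

Lemma size_ge_rel S x y N : is_eq_str S -> dom S x -> dom S y -> rel S x y ->
  size_ge S x N -> size_ge S y N.
Proof.
  intros (Hr & Hs & Ht) Hx Hy Hxy (l & H1 & H2 & H3). exists l.
  split; [|split]; trivial. intros z Hz. destruct (H3 z Hz). split; trivial. eauto.
Qed.

Lemma size_ge_embedding S T f x N : embedding S T f -> dom S x ->
  size_ge S x N -> size_ge T (f x) N.
Proof.
  intros (Hd & Hi & Hr) Hx (l & H1 & H2 & H3). exists (map f l). split; [|split].
  - apply NoDup_map_NoDup_ForallPairs; trivial.
    intros a b Ha Hb. apply Hi; now apply H3.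
  - now rewrite length_map.
  - intros y (z & <- & Hz)%in_map_iff. destruct (H3 z Hz). split; [now apply Hd|].
    now apply Hr.
Qed.

Lemma infinite_class_rel S x y : is_eq_str S -> dom S x -> dom S y -> rel S x y ->
  infinite_class S x -> infinite_class S y.
Proof. rewrite !infinite_class_size. eauto using size_ge_rel. Qed.

Lemma infinite_class_embedding S T f x : embedding S T f -> dom S x ->
  infinite_class S x -> infinite_class T (f x).
Proof. rewrite !infinite_class_size. eauto using size_ge_embedding. Qed.

(** * Embeddings from maps between classes *)

(** Asking classically whether [p] is computable gives one function that is a search if possible and
    a mere choice otherwise, so each embedding is built only once. *)
Lemma search_or_choice (p : nat -> nat -> bool) :
  (forall x, exists n, p x n = true) ->
  exists f, (forall x, p x (f x) = true) /\
    (computable_bool (fun v => p (pfst v) (psnd v)) -> computable f).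
Proof.
  intros H. destruct (classic (computable_bool (fun v => p (pfst v) (psnd v)))) as [Hp|Hp].
  - destruct (computable_search p Hp H) as (f & Hf & Hs). now exists f.
  - destruct (choice _ H) as [f Hf]. now exists f.
Qed.

Section Embeddings.
Context (S T : str) (dS dT : nat -> bool) (rS rT : nat -> nat -> bool).
Context (HS : is_eq_str S) (HT : is_eq_str T).
Context (decS : decides S dS rS) (decT : decides T dT rT).

Let computable_S : Prop := computable_bool dS /\
  computable_bool (fun n => rS (pfst n) (psnd n)).
Let computable_T : Prop := computable_bool dT /\
  computable_bool (fun n => rT (pfst n) (psnd n)).

Lemma computable_member d r x y :
  computable_bool d -> computable_bool (fun n => r (pfst n) (psnd n)) ->
  computable x -> computable y -> computable_bool (fun v => member d r (x v) (y v)).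
Proof.
  intros. unfold member. apply computable_andb.
  - now apply (computable_bool_comp d).
  - now apply (computable_bool_comp2 r).
Qed.

Lemma computable_count_member d r x s :
  computable_bool d -> computable_bool (fun n => r (pfst n) (psnd n)) ->
  computable x -> computable s -> computable (fun v => count (member d r (x v)) (s v)).
Proof.
  intros. apply (computable_count (fun v => member d r (x v))); trivial.
  apply computable_member; trivial; [apply (computable_comp x)|]; computability.
Qed.

Lemma member_ext x y : dom S x -> dom S y -> rel S x y ->
  forall z, member dS rS x z = member dS rS y z.
Proof.
  intros Hx Hy Hxy z. destruct HS as (Hr & Hs & Ht). apply eq_iff_eq_true.
  rewrite <- !(member_spec _ _ _ decS). unfold eq_class.
  split; intros [Hz H]; split; trivial; [apply (Ht _ x)|apply (Ht _ y)]; auto.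
Qed.

(* [g x] is the element of the class of [t x] whose rank there equals the rank of [x]
   in its own class. *)
Lemma embedding_of_class_map t :
  (forall x, dom S x -> dom T (t x)) ->
  (forall x y, dom S x -> dom S y -> (rel S x y <-> rel T (t x) (t y))) ->
  (forall x N, dom S x -> size_ge S x N -> size_ge T (t x) N) ->
  exists g, embedding S T g /\
    (computable_S -> computable_T -> computable t -> computable g).
Proof.
  intros Hdom Hrel Hsize. pose proof HT as (HTr & HTs & HTt). pose proof HS as (HSr & _ & _).
  destruct (search_or_choice (fun x z => if dS x then member dT rT (t x) z &&
      (count (member dT rT (t x)) z =? count (member dS rS x) x) else true))
    as (g & Hg & Hc).
  { intros x. destruct (dS x) eqn:Ex; [|now exists 0].
    assert (Hx : dom S x) by now apply decS.
    (* The members of the class of [x] up to and including [x] number its rank plus one; the target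
       class has as many, hence a member of that rank. *)
    destruct (Hsize x (count (member dS rS x) (1 + x))) as (l & Hl) ; trivial.
    { apply (size_ge_count _ _ _ _ _ decS). now exists (1 + x). }
    destruct (proj1 (size_ge_count _ _ _ _ _ decT) (ex_intro _ l Hl)) as [s Hs].
    cbn [plus] in Hs. rewrite count_S in Hs.
    rewrite (proj1 (member_spec _ _ _ decS x x)) in Hs by (split; auto).
    cbn in Hs. destruct (count_hit (member dT rT (t x)) s (count (member dS rS x) x))
      as (z & Hz & E); [lia|].
    exists z. now rewrite Hz, E, Nat.eqb_refl. }
  assert (Hg' : forall x, dom S x -> eq_class T (t x) (g x) /\
    count (member dT rT (t x)) (g x) = count (member dS rS x) x).
  { intros x Hx. specialize (Hg x). apply decS in Hx. rewrite Hx in Hg.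
    apply andb_true_iff in Hg as [H1 H2]. apply Nat.eqb_eq in H2. split; trivial.
    now apply (member_spec _ _ _ decT). }
  assert (Hgrel : forall x y, dom S x -> dom S y -> (rel S x y <-> rel T (g x) (g y))).
  { intros x y Hx Hy. rewrite Hrel by trivial.
    destruct (Hg' x Hx) as [[H1 H2] _], (Hg' y Hy) as [[H3 H4] _].
    pose proof (Hdom x Hx) as Htx. pose proof (Hdom y Hy) as Hty.
    split; intros H.
    - apply (HTt _ (t x)); auto. apply (HTt _ (t y)); auto.
    - apply (HTt _ (g x)); auto. apply (HTt _ (g y)); auto. }
  exists g. split; [split; [|split]|].
  - intros x Hx. apply Hg', Hx.
  - intros x y Hx Hy E.
    assert (Hxy : rel S x y).
    { apply Hgrel; trivial. rewrite E. apply HTr. now apply Hg'. }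
    destruct (Hg' x Hx) as [_ H1], (Hg' y Hy) as [_ H2].
    assert (Hm : forall z, member dT rT (t x) z = member dT rT (t y) z).
    { intros z. apply eq_iff_eq_true. rewrite <- !(member_spec _ _ _ decT).
      apply Hrel in Hxy; trivial. pose proof (Hdom x Hx). pose proof (Hdom y Hy).
      unfold eq_class. split; intros [Hz Hxz]; split; trivial.
      - apply (HTt _ (t x)); auto.
      - apply (HTt _ (t y)); auto. }
    apply (count_inj (member dS rS x)).
    + apply (member_spec _ _ _ decS). split; auto.
    + apply (member_spec _ _ _ decS). now split.
    + rewrite <- H1. rewrite (count_ext _ _ _ (member_ext x y Hx Hy Hxy)).
      rewrite <- H2, E. apply count_ext. intros; apply Hm.
  - exact Hgrel.
  - intros [] [] Ht. apply Hc.
    assert (computable (fun v => t (pfst v))) by (apply (computable_comp t); computability).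
    apply computable_bool_if; [apply (computable_bool_comp dS)| |]; computability.
    + apply computable_member; computability.
    + apply computable_count_member; computability.
    + apply computable_count_member; computability.
Qed.

Fixpoint class_lookup (F : list (nat * nat)) (t : nat -> nat) (x : nat) : nat :=
  match F with
  | [] => t x
  | (r, c) :: F => if rS r x then c else class_lookup F t x
  end.

Lemma class_lookup_spec F t x :
  (exists r c, In (r, c) F /\ rel S r x /\ class_lookup F t x = c) \/
  ((forall r c, In (r, c) F -> ~ rel S r x) /\ class_lookup F t x = t x).
Proof.
  induction F as [|[r c] F IH]; cbn.
  - right. now split.
  - destruct (rS r x) eqn:E.
    + left. exists r, c. split; [auto|]. split; trivial. now apply decS.
    + destruct IH as [(r' & c' & H1 & H2 & H3)|[H1 H2]].
      * left. exists r', c'. auto.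
      * right. split; trivial. intros r' c' [[= <- <-]|H]; [|eauto].
        intros Hr. apply decS in Hr. congruence.
Qed.

(* The finitely many classes represented in [F] are matched by hand; any other class is
   sent to the class of [c' n], with [n] its least element. *)
Lemma embedding_of_matching F c' :
  (forall r c, In (r, c) F -> dom S r /\ dom T c /\
     forall N, size_ge S r N -> size_ge T c N) ->
  (forall r c r' c', In (r, c) F -> In (r', c') F -> (rel S r r' <-> rel T c c')) ->
  (forall n, dom S n -> (forall r c, In (r, c) F -> ~ rel S r n) ->
     dom T (c' n) /\ (forall N, size_ge S n N -> size_ge T (c' n) N) /\
     (forall r c, In (r, c) F -> ~ rel T c (c' n)) /\
     (forall m, dom S m -> (forall r c, In (r, c) F -> ~ rel S r m) ->
        rel T (c' n) (c' m) -> n = m)) ->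
  exists g, embedding S T g /\
    (computable_S -> computable_T -> computable c' -> computable g).
Proof.
  intros H1 H2 H3. pose proof HT as (HTr & HTs & HTt). pose proof HS as (HSr & HSs & HSt).
  (* [rep x] has rank 0, so it is the least element of the class of [x]. Off the domain every value
     is accepted, which keeps the search total. *)
  destruct (search_or_choice (fun x y => if dS x then member dS rS x y &&
      (count (member dS rS x) y =? 0) else true)) as (rep & Hrep & Hc).
  { intros x. destruct (dS x) eqn:Ex; [|now exists 0].
    assert (Hx : dom S x) by now apply decS.
    destruct (count_hit (member dS rS x) (1 + x) 0) as (z & Hz & E).
    { cbn [plus]. rewrite count_S, (proj1 (member_spec _ _ _ decS x x)) by (split; auto).
      cbn. lia. }
    exists z. now rewrite Hz, E. }
  assert (Hrep' : forall x, dom S x -> eq_class S x (rep x) /\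
    count (member dS rS x) (rep x) = 0).
  { intros x Hx. specialize (Hrep x). apply decS in Hx. rewrite Hx in Hrep.
    apply andb_true_iff in Hrep as [h1 h2]. apply Nat.eqb_eq in h2. split; trivial.
    now apply (member_spec _ _ _ decS). }
  assert (Hrep_rel : forall x y, dom S x -> dom S y -> rel S x y -> rep x = rep y).
  { intros x y Hx Hy Hxy. destruct (Hrep' x Hx) as [h1 h2], (Hrep' y Hy) as [h3 h4].
    apply (count_inj (member dS rS x)).
    - now apply (member_spec _ _ _ decS).
    - rewrite (member_ext x y) by trivial. now apply (member_spec _ _ _ decS).
    - rewrite h2, (count_ext _ _ _ (member_ext x y Hx Hy Hxy)). congruence. }
  set (t := class_lookup F (fun x => c' (rep x))).
  assert (Ht : forall x, dom S x ->
    (exists r c, In (r, c) F /\ rel S r x /\ t x = c) \/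
    ((forall r c, In (r, c) F -> ~ rel S r x) /\ dom S (rep x) /\ rel S x (rep x) /\
     (forall r c, In (r, c) F -> ~ rel S r (rep x)) /\ t x = c' (rep x))).
  { intros x Hx. destruct (class_lookup_spec F (fun x => c' (rep x)) x) as [h|[h1 h2]];
      [now left|right]. destruct (Hrep' x Hx) as [[h3 h4] _].
    repeat split; trivial. intros r c Hin Hr. apply (h1 r c Hin).
    apply (HSt _ (rep x)); auto. now apply (H1 r c). }
  destruct (embedding_of_class_map t) as (g & Hg & Hgc).
  - intros x Hx. destruct (Ht x Hx) as [(r & c & h1 & h2 & ->)|(h1 & h2 & h3 & h4 & ->)].
    + now apply (H1 r c).
    + now apply H3.
  - intros x y Hx Hy.
    destruct (Ht x Hx) as [(r & c & h1 & h2 & ->)|(h1 & h2 & h3 & h4 & ->)];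
    destruct (Ht y Hy) as [(s & d & k1 & k2 & ->)|(k1 & k2 & k3 & k4 & ->)].
    + destruct (H1 _ _ h1) as (? & ? & _), (H1 _ _ k1) as (? & ? & _).
      rewrite <- (H2 r c s d) by trivial. split; intros h.
      * apply (HSt _ x); auto. apply (HSt _ y); auto.
      * apply (HSt _ r); auto. apply (HSt _ s); auto.
    + destruct (H1 _ _ h1) as (? & ? & _). split; intros h; exfalso.
      * apply (k1 r c h1). apply (HSt _ x); auto.
      * revert h. now apply (H3 _ k2 k4) with r.
    + destruct (H1 _ _ k1) as (? & ? & _). split; intros h; exfalso.
      * apply (h1 s d k1). apply (HSt _ y); auto.
      * destruct (H3 _ h2 h4) as (? & _ & h5 & _). apply (h5 s d k1). auto.
    + split; intros h.
      * rewrite (Hrep_rel x y) by trivial. apply HTr. now apply H3.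
      * apply (H3 _ h2 h4) in h; trivial. apply (HSt _ (rep x)); auto.
        rewrite h. auto.
  - intros x N Hx HN.
    destruct (Ht x Hx) as [(r & c & h1 & h2 & ->)|(h1 & h2 & h3 & h4 & ->)].
    + apply (H1 r c h1). apply (size_ge_rel S x); auto; [now apply (H1 r c)|].
      apply HSs; trivial. now apply (H1 r c).
    + apply H3; trivial. now apply (size_ge_rel S x).
  - exists g. split; trivial. intros HcS HcT Hc'. apply Hgc; trivial.
    destruct HcS as [HcS1 HcS2].
    assert (computable rep).
    { apply Hc. apply computable_bool_if; [apply (computable_bool_comp dS)| |];
        computability.
      - apply computable_member; computability.
      - apply computable_count_member; computability. }
    unfold t. clear - HcS2 Hc' H. induction F as [|[r c] F IH]; cbn.
    + apply (computable_comp c'); trivial.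
    + apply computable_if; computability. apply (computable_bool_comp2 rS); computability.
Qed.

End Embeddings.

(** * Structures with finitely many infinite and unboundedly large finite classes *)

(** Having exactly [k] infinite classes becomes this for [k] together with its negation for [1 + k],
    a Sigma_3 and a Pi_3 half. *)
Definition inf_classes_ge (S : str) (k : nat) : Prop :=
  exists r : nat -> nat, (forall i, i < k -> dom S (r i) /\ infinite_class S (r i)) /\
    forall i j, i < k -> j < k -> rel S (r i) (r j) -> i = j.

Definition unbounded_finite (S : str) : Prop :=
  forall N, exists x, dom S x /\ ~ infinite_class S x /\ size_ge S x N.

(** An infinite class missed by [r] would serve as one more representative. *)
Lemma inf_classes_cover S k r x : is_eq_str S ->
  (forall i, i < k -> dom S (r i) /\ infinite_class S (r i)) ->
  (forall i j, i < k -> j < k -> rel S (r i) (r j) -> i = j) ->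
  ~ inf_classes_ge S (1 + k) -> dom S x -> infinite_class S x ->
  exists i, i < k /\ rel S (r i) x.
Proof.
  intros (_ & HS & _) Hr Hinj Hn Hx Hinf. apply NNPP. intros H. apply Hn.
  exists (fun i => if i <? k then r i else x). split.
  - intros i Hi. destruct (Nat.ltb_spec i k); auto.
  - intros i j Hi Hj. destruct (Nat.ltb_spec i k), (Nat.ltb_spec j k); auto.
    + intros E. exfalso. eauto.
    + intros E. exfalso. apply H. exists j. split; trivial. apply HS; trivial.
      now apply Hr.
    + lia.
Qed.

Lemma has_k_infinite_classes_ge A k : is_eq_str A -> has_k_infinite_classes A k ->
  inf_classes_ge A k /\ ~ inf_classes_ge A (1 + k).
Proof.
  intros (HR & HS & HT) (l & Hk & Hl & Hinj & Hcov). split.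
  - exists (fun i => nth i l 0). split; trivial. intros i Hi. apply Hl, nth_In. lia.
  - intros (r & Hr & Hrinj).
    destruct (choice (fun i y => i < 1 + k -> In y l /\ rel A (r i) y)) as [c Hc].
    { intros i. destruct (le_lt_dec (1 + k) i); [exists 0; lia|].
      destruct (Hcov (r i)) as [y Hy]; [now apply Hr..|]. now exists y. }
    enough (length (map c (seq 0 (1 + k))) <= length l)
      by (rewrite length_map, length_seq in *; lia).
    apply NoDup_incl_length.
    + apply NoDup_map_NoDup_ForallPairs; [|apply seq_NoDup].
      intros i j Hi%in_seq Hj%in_seq E. apply Hrinj; [lia..|].
      destruct (Hc i) as [H1 H2], (Hc j) as [H3 H4]; try lia.
      destruct (Hr i), (Hr j); try lia. apply (HT _ (c i)); auto; [now apply Hl|].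
      apply HS; auto; [now apply Hl|]. now rewrite E.
    + intros y (i & <- & Hi%in_seq)%in_map_iff. apply Hc. lia.
Qed.

Lemma inf_classes_embedding S T f k : embedding S T f ->
  inf_classes_ge S k -> inf_classes_ge T k.
Proof.
  intros Hf (r & Hr & Hinj). exists (fun i => f (r i)). split.
  - intros i Hi. destruct (Hr i Hi). split; [now apply Hf|].
    now apply (infinite_class_embedding S).
  - intros i j Hi Hj E. apply Hinj; trivial. apply Hf; trivial; now apply Hr.
Qed.

(** The images of the [k] infinite classes use up the infinite classes of [T]. A finite class of [S]
    landing in an infinite one would make [1 + k] of them. *)
Lemma unbounded_finite_embedding S T f k : is_eq_str S -> embedding S T f ->
  inf_classes_ge S k -> ~ inf_classes_ge T (1 + k) ->
  unbounded_finite S -> unbounded_finite T.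
Proof.
  intros HS Hf (r & Hr & Hinj) HT HU N.
  destruct (HU N) as (x & Hx & Hfin & HN). exists (f x). split; [now apply Hf|].
  split; [|now apply (size_ge_embedding S)]. intros Hinf. apply HT.
  assert (Hnr : forall i, i < k -> ~ rel S (r i) x).
  { intros i Hi E. apply Hfin. apply (infinite_class_rel S (r i)); trivial; now apply Hr. }
  exists (fun i => f (if i <? k then r i else x)). split.
  - intros i Hi. destruct (Nat.ltb_spec i k); [|split; trivial; now apply Hf].
    destruct (Hr i); trivial. split; [now apply Hf|]. now apply (infinite_class_embedding S).
  - intros i j Hi Hj E. apply Hf in E; destruct (Nat.ltb_spec i k), (Nat.ltb_spec j k);
      trivial; try (now apply Hr); auto.
    + exfalso. now apply (Hnr i).
    + exfalso. apply (Hnr j); trivial. apply HS; trivial. now apply Hr.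
    + lia.
Qed.

(** [Ce e] may fail to be an equivalence structure; embedding into [A] forces it to be one. *)
Lemma is_eq_str_embedding S T f : embedding S T f -> is_eq_str T -> is_eq_str S.
Proof.
  intros (Hd & _ & Hr) (HR & HS & HT). split; [|split].
  - intros x Hx. apply Hr; auto.
  - intros x y Hx Hy. rewrite !Hr by trivial. auto.
  - intros x y z Hx Hy Hz. rewrite !Hr by trivial. apply HT; auto.
Qed.

(** Infinite classes are matched by index, and the finite class with least element [n] goes to the
    [n]-th term of a sequence of finite classes of [T] that are large enough and strictly growing in
    size, hence distinct. *)
Lemma unbounded_finite_embeds S T k : is_eq_str S -> is_eq_str T ->
  inf_classes_ge S k -> ~ inf_classes_ge S (1 + k) ->
  inf_classes_ge T k -> unbounded_finite T -> exists g, embedding S T g.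
Proof.
  intros HS HT (r & Hr & Hrinj) HnS (c & Hc & Hcinj) HU.
  destruct (choice _ HU) as [C HC].
  (* [M N] is a size that the finite class of [C N] does not reach; [s n] below is one that the
     class of [n] does not reach, if finite. *)
  destruct (choice (fun N M => ~ size_ge T (C N) M)) as [M HM].
  { intros N. apply not_all_ex_not. rewrite <- infinite_class_size. apply HC. }
  destruct (choice (fun n s => dom S n -> ~ infinite_class S n -> ~ size_ge S n s))
    as [s Hs].
  { intros n. destruct (classic (dom S n /\ ~ infinite_class S n)) as [[H1 H2]|H].
    - rewrite infinite_class_size in H2. apply not_all_ex_not in H2 as [m Hm].
      now exists m.
    - exists 0. tauto. }
  assert (HMN : forall N, N < M N).
  { intros N. destruct (le_lt_dec (M N) N) as [h|h]; trivial. exfalso. apply (HM N).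
    now apply (size_ge_le _ _ _ N); [|apply HC]. }
  (* The class of [C (h n)] has at least [h n] but fewer than [h (n + 1)] elements. *)
  set (h := nat_rect (fun _ => nat) (s 0) (fun n a => Nat.max (M a) (s (1 + n)))).
  assert (Hh : forall n m, n < m -> M (h n) <= h m).
  { intros n m Hlt. induction Hlt as [|m Hlt IH]; cbn; [lia|]. specialize (HMN (h m)).
    fold (h m). lia. }
  assert (Hsh : forall n, s n <= h n) by (intros [|n]; cbn; lia).
  assert (Hlt : forall n m, n < m -> ~ rel T (C (h n)) (C (h m))).
  { intros n m Hnm E. apply (HM (h n)).
    apply (size_ge_rel T (C (h m))); trivial; try apply HC.
    - apply HT; trivial; apply HC.
    - apply (size_ge_le _ _ _ (h m)); [now apply Hh|apply HC]. }
  destruct (decides_exists S) as (dS & rS & decS), (decides_exists T) as (dT & rT & decT).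
  destruct (embedding_of_matching S T dS dT rS rT HS HT decS decT
    (map (fun i => (r i, c i)) (seq 0 k)) (fun n => C (h n))) as (g & Hg & _).
  - intros r' c' (i & [= <- <-] & Hi%in_seq)%in_map_iff.
    split; [apply Hr; lia|]. split; [apply Hc; lia|]. intros N _.
    apply infinite_class_size, Hc. lia.
  - intros r1 c1 r2 c2 (i & [= <- <-] & Hi%in_seq)%in_map_iff
      (j & [= <- <-] & Hj%in_seq)%in_map_iff.
    split; intros E.
    + replace j with i by (apply Hrinj; trivial; lia). apply (proj1 HT), Hc. lia.
    + replace j with i by (apply Hcinj; trivial; lia). apply (proj1 HS), Hr. lia.
  - intros n Hn Hnr.
    assert (Hfin : ~ infinite_class S n).
    { intros Hinf. destruct (inf_classes_cover S k r n) as (i & Hi & E); trivial.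
      apply (Hnr (r i) (c i)); trivial. apply in_map_iff. exists i. split; trivial.
      apply in_seq. lia. }
    split; [apply HC|]. split; [|split].
    + intros N HN. apply (size_ge_le _ _ _ (h n)); [|apply HC].
      destruct (le_lt_dec (s n) N) as [HsN|]; [|specialize (Hsh n); lia].
      exfalso. apply (Hs n Hn Hfin). now apply (size_ge_le _ _ _ N).
    + intros r' c' (i & [= <- <-] & Hi%in_seq)%in_map_iff E.
      destruct (HC (h n)) as (h1 & h2 & h3). apply h2.
      apply (infinite_class_rel T (c i)); trivial; apply Hc; lia.
    + intros m Hm _ E. destruct (Nat.lt_trichotomy n m) as [h'|[h'|h']]; trivial; exfalso.
      * now apply (Hlt n m).
      * apply (Hlt m n h'). apply HT; trivial; apply HC.
  - now exists g.
Qed.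

Lemma bi_embeddable_unbounded A S k : is_eq_str A ->
  inf_classes_ge A k -> ~ inf_classes_ge A (1 + k) -> unbounded_finite A ->
  (bi_embeddable S A <-> is_eq_str S /\
    inf_classes_ge S k /\ ~ inf_classes_ge S (1 + k) /\ unbounded_finite S).
Proof.
  intros HA H1 H2 H3. split.
  - intros [[f Hf] [g Hg]].
    assert (HS2 : ~ inf_classes_ge S (1 + k)).
    { intros H. apply H2. now apply (inf_classes_embedding S _ f). }
    split; [now apply (is_eq_str_embedding S A f)|].
    split; [now apply (inf_classes_embedding A _ g)|]. split; trivial.
    now apply (unbounded_finite_embedding A _ g k).
  - intros (HS & HS1 & HS2 & HS3). split; now apply unbounded_finite_embeds with k.
Qed.

(** * The complexity of the index set *)

(** One number codes a whole tuple, so choosing [k] representatives costs a single existential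
    quantifier. *)
Definition component (i z : nat) : nat := pfst (Nat.iter i psnd z).

Lemma component_exists k (r : nat -> nat) : exists z, forall i, i < k -> component i z = r i.
Proof.
  revert r. induction k as [|k IH]; intros r.
  - exists 0. lia.
  - destruct (IH (fun i => r (S i))) as [z Hz]. exists (pair (r 0) z).
    unfold component in *. intros [|i] Hi.
    + apply pfst_pair.
    + rewrite Nat.iter_succ_r, psnd_pair. apply Hz. lia.
Qed.

Lemma computable_component i f : computable f -> computable (fun x => component i (f x)).
Proof.
  intros Hf. apply computable_pfst, (computable_iter (fun _ => psnd)); computability.
Qed.

(** Finitely many acceptances, and the elements concerned, are all bounded by one stage; this makes
    the size condition Sigma_1. *)
Lemma size_ge_Ce e x N :
  size_ge (Ce e) x N <-> exists s, N <= count (fun y => accepts_by s e (pair x y)) s.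
Proof.
  split.
  - intros (l & Hl & HN & H).
    assert (Hs : exists s, forall y, In y l -> y < s /\ accepts_by s e (pair x y) = true).
    { clear Hl HN. induction l as [|a l IH]; [now exists 0|].
      destruct IH as [s Hs]; [intros; apply H; now right|].
      destruct (H a) as [_ Ha]; [now left|]. apply accepts_by_spec in Ha as [t Ht].
      exists (1 + a + s + t). intros y [<-|Hy].
      - split; [lia|]. apply (accepts_by_mono t); trivial. lia.
      - destruct (Hs y Hy). split; [lia|]. apply (accepts_by_mono s); trivial. lia. }
    destruct Hs as [s Hs]. exists s. etransitivity; [apply HN|].
    now apply NoDup_count_ge.
  - intros [s Hs]. destruct (count_ge_NoDup _ _ _ Hs) as (l & H1 & H2 & H3).
    exists l. split; [|split]; trivial. intros y Hy. split; [exact I|].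
    apply accepts_by_spec. exists s. auto.
Qed.

Ltac computability_with f :=
  repeat first [computable_step | apply (computable_comp f)].

Lemma arith_rel e x y : computable e -> computable x -> computable y ->
  arith true 1 (fun v => rel (Ce (e v)) (x v) (y v)).
Proof. intros. apply (arith_phi e (fun v => pair (x v) (y v))); computability. Qed.

(** The Sigma_1 relation is absorbed by the existential quantifier over members, so it costs no
    extra alternation. *)
Lemma arith_infinite_class e x : computable e -> computable x ->
  arith false 2 (fun v => infinite_class (Ce (e v)) (x v)).
Proof.
  intros He Hx. unfold infinite_class, infinite_set, eq_class.
  apply arith_forall, (arith_lift true), arith_exists, arith_and, arith_and.
  - eapply arith_ext; [intros v; apply Nat.leb_le|]. apply arith_bool. computability.
  - apply (arith_const _ _ True).
  - apply (arith_rel (fun v => e (pfst (pfst v))) (fun v => x (pfst (pfst v))));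
      computability_with e; computability_with x.
Qed.

Lemma arith_is_eq_str : arith false 2 (fun e => is_eq_str (Ce e)).
Proof.
  apply (arith_ext _ _ (fun e => (forall x, rel (Ce e) x x) /\
    (forall x y, ~ rel (Ce e) x y \/ rel (Ce e) y x) /\
    (forall x y z, (~ rel (Ce e) x y \/ ~ rel (Ce e) y z) \/ rel (Ce e) x z))).
  { intros e. split.
    - intros (H1 & H2 & H3). split; [auto|split].
      + intros x y _ _. destruct (H2 x y); tauto.
      + intros x y z _ _ _. destruct (H3 x y z); tauto.
    - intros (H1 & H2 & H3). split; [|split].
      + intros x. now apply H1.
      + intros x y. destruct (classic (rel (Ce e) x y)) as [h|h]; [right|tauto].
        now apply H2.
      + intros x y z. destruct (classic (rel (Ce e) x y)) as [h|h]; [|tauto].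
        destruct (classic (rel (Ce e) y z)) as [h'|h']; [right|tauto].
        now apply (H3 x y z). }
  assert (Hrel : forall e x y, computable e -> computable x -> computable y ->
    arith false 2 (fun v => rel (Ce (e v)) (x v) (y v)))
    by (intros; now apply (arith_lift true), arith_rel).
  assert (Hnrel : forall e x y, computable e -> computable x -> computable y ->
    arith false 2 (fun v => ~ rel (Ce (e v)) (x v) (y v)))
    by (intros; now apply (arith_lift false), (arith_not true), arith_rel).
  apply arith_and; [|apply arith_and]; repeat apply arith_forall; repeat apply arith_or;
    (apply Hrel || apply Hnrel); computability.
Qed.

Lemma arith_inf_classes_ge k : arith true 3 (fun e => inf_classes_ge (Ce e) k).
Proof.
  apply (arith_ext _ _ (fun e => exists z,
    (forall i, i < k -> infinite_class (Ce e) (component i z)) /\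
    forall i, i < k -> forall j, j < k ->
      ~ rel (Ce e) (component i z) (component j z) \/ i = j)).
  - intros e. split.
    + intros (z & H1 & H2). exists (fun i => component i z). split.
      * intros i Hi. split; [exact I|auto].
      * intros i j Hi Hj E. destruct (H2 i Hi j Hj); tauto.
    + intros (r & H1 & H2). destruct (component_exists k r) as [z Hz]. exists z. split.
      * intros i Hi. rewrite Hz by trivial. now apply H1.
      * intros i Hi j Hj. rewrite !Hz by trivial.
        destruct (classic (rel (Ce e) (r i) (r j))); auto.
  - apply arith_exists, (arith_lift false), arith_and.
    + apply (arith_forall_lt _ _ _ (fun i v => infinite_class (Ce (pfst v))
        (component i (psnd v)))).
      intros i _. apply arith_infinite_class; [|apply computable_component]; computability.
    + apply (arith_forall_lt _ _ _ (fun i v => forall j, j < k ->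
        ~ rel (Ce (pfst v)) (component i (psnd v)) (component j (psnd v)) \/ i = j)).
      intros i _. apply (arith_forall_lt _ _ _ (fun j v =>
        ~ rel (Ce (pfst v)) (component i (psnd v)) (component j (psnd v)) \/ i = j)).
      intros j _. apply arith_or; [|apply arith_const].
      apply (arith_lift false), (arith_not true), arith_rel;
        try apply computable_component; computability.
Qed.

(** Finiteness of a class is Sigma_2 and the size condition Sigma_1; both are absorbed by the
    quantifier over [x]. *)
Lemma arith_unbounded_finite : arith false 3 (fun e => unbounded_finite (Ce e)).
Proof.
  apply (arith_ext _ _ (fun e => forall N, exists x, ~ infinite_class (Ce e) x /\
    exists s, (N <=? count (fun y => accepts_by s e (pair x y)) s) = true)).
  - intros e. split; intros H N; destruct (H N) as [x Hx]; exists x.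
    + split; [exact I|]. split; [apply Hx|]. apply size_ge_Ce.
      destruct Hx as (_ & s & Hs). exists s. now apply Nat.leb_le.
    + destruct Hx as (_ & H1 & H2). split; trivial. apply size_ge_Ce in H2 as [s Hs].
      exists s. now apply Nat.leb_le.
  - apply arith_forall, (arith_lift true), arith_exists, arith_and.
    + apply (arith_not false), arith_infinite_class; computability.
    + apply arith_exists, arith_bool, computable_leb; [computability|].
      apply (computable_count (fun v y => accepts_by (psnd v) (pfst (pfst (pfst v)))
        (pair (psnd (pfst v)) y))); [apply computable_accepts_by|]; computability.
Qed.

(** * Hardness *)

Fixpoint constant_code (n : nat) : code :=
  match n with 0 => CZero | S n => CComp CSucc (constant_code n) end.

Lemma ev_constant_code O n x : ev O (constant_code n) x n.
Proof. induction n; cbn; econstructor; eauto using ev. Qed.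

Lemma computable_smn (h : nat -> nat -> nat) :
  computable (fun v => h (pfst v) (psnd v)) ->
  exists f, computable f /\ forall x n, phi empty_oracle (f x) n (h x n).
Proof.
  intros [c Hc]%computable_iff.
  exists (fun x => encode (CComp c (CPair (constant_code x) CId))). split.
  - cbn [encode].
    assert (computable (fun x => encode (constant_code x))).
    { apply (computable_ext (fun x => Nat.iter x (fun r => pair 1 r * 10 + 6) 0)).
      - induction x as [|x IH]; [reflexivity|]. rewrite Nat.iter_succ, IH. reflexivity.
      - apply (computable_iter (fun _ r => pair 1 r * 10 + 6)); computability. }
    computability.
  - intros x n. unfold phi. rewrite prog_encode. specialize (Hc (pair x n)).
    rewrite pfst_pair, psnd_pair in Hc.
    econstructor; [|exact Hc]. constructor; [apply ev_constant_code|constructor].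
Qed.

(* [progress R a s] moves from [b] to [b + 1] at a stage whose first component is some
   [c] with [R a b c]; every [c] is proposed infinitely often. *)
Definition progress (R : nat -> nat -> nat -> bool) (a s : nat) : nat :=
  nat_rect (fun _ => nat) 0 (fun s p => p + b2n (R a p (pfst s))) s.

Definition fires (R : nat -> nat -> nat -> bool) (a s : nat) : bool :=
  R a (progress R a s) (pfst s).

Lemma progress_S R a s : progress R a (S s) = progress R a s + b2n (fires R a s).
Proof. reflexivity. Qed.

Lemma progress_mono R a s t : s <= t -> progress R a s <= progress R a t.
Proof. induction 1; trivial. rewrite progress_S. lia. Qed.

Definition total_row (R : nat -> nat -> nat -> bool) (a : nat) : Prop :=
  forall b, exists c, R a b c = true.

(** Progress leaves [b] only by a firing that exhibits a witness for [b]. Conversely, if firing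
    stopped, progress would be stuck at a value whose witness is still proposed later. *)
Lemma fires_infinitely_often R a :
  infinite_set (fun s => fires R a s = true) <-> total_row R a.
Proof.
  unfold total_row. split.
  - intros H b.
    assert (Hp : forall b, exists s, b <= progress R a s).
    { induction b0 as [|b' [s Hs]]; [exists 0; lia|].
      destruct (H s) as (t & Ht & Hf). exists (S t). rewrite progress_S, Hf.
      pose proof (progress_mono R a s t Ht). cbn. lia. }
    destruct (Hp (S b)) as [s Hs]. clear Hp.
    induction s as [|s IH]; [cbn in Hs; lia|].
    destruct (le_lt_dec (S b) (progress R a s)) as [h|h]; [auto|].
    rewrite progress_S in Hs. destruct (fires R a s) eqn:E; cbn in Hs; [|lia].
    unfold fires in E. replace (progress R a s) with b in E by lia. eauto.
  - intros H n. apply NNPP. intros Hn.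
    assert (Hp : forall s, n <= s -> progress R a s = progress R a n).
    { induction 1 as [|s Hs IH]; trivial. rewrite progress_S, IH.
      destruct (fires R a s) eqn:E; cbn; [|lia]. exfalso. eauto. }
    (* Stage [pair c n] is at least [n] and proposes [c]. *)
    destruct (H (progress R a n)) as [c Hc]. apply Hn. exists (pair c n).
    destruct (pair_ge c n) as [_ Hge]. split; trivial.
    unfold fires. now rewrite pfst_pair, Hp.
Qed.

Lemma infinite_set_le (P Q : nat -> Prop) : (forall s, P s -> Q s) ->
  infinite_set P -> infinite_set Q.
Proof. intros H HP n. destruct (HP n) as (m & Hm & Hp). eauto. Qed.

Lemma not_infinite_set P : ~ infinite_set P -> exists n, forall s, n <= s -> ~ P s.
Proof.
  intros H. apply not_all_ex_not in H as [n Hn]. exists n. intros s Hs HP. eauto.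
Qed.

Definition injured (R : nat -> nat -> nat -> bool) (a s : nat) : bool :=
  0 <? count (fun a' => fires R a' s) a.

Definition injuries (R : nat -> nat -> nat -> bool) (a s : nat) : nat :=
  count (injured R a) s.

Lemma injured_iff R a s : injured R a s = true <->
  exists a', a' < a /\ fires R a' s = true.
Proof.
  unfold injured. rewrite Nat.ltb_lt. split.
  - intros H. unfold count in H.
    destruct (filter _ _) as [|b l] eqn:E in H; [cbn in H; lia|].
    assert (Hb : In b (filter (fun a' => fires R a' s) (seq 0 a))) by (rewrite E; now left).
    apply filter_In in Hb as [Hb%in_seq Hf]. exists b. split; trivial. lia.
  - intros (a' & Ha & Hf). pose proof (count_mono (fun a' => fires R a' s) _ _ Ha) as H.
    rewrite count_S, Hf in H. cbn in H. lia.
Qed.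

(* A number codes [pair tag (pair a s)].  Tag 0 gives the finite classes; tag 1 has an
   infinite class iff some [a] fires infinitely often for [R1], and then exactly one: the
   least such [a] keeps its class after its last injury.  Tags 2 and 3 duplicate each
   other, so that a failure of the Pi_3 condition adds two infinite classes and cannot be
   compensated by a failure of the Sigma_3 one.  Tag 4 gives [m] further infinite classes. *)
Section Labels.
Context (R1 R2 : nat -> nat -> nat -> bool) (m : nat).

Let tag (n : nat) := pfst n.
Let arg (n : nat) := pfst (psnd n).
Let stage (n : nat) := psnd (psnd n).

Definition active (n : nat) : bool :=
  ((tag n =? 0) && (stage n <=? arg n)) ||
  ((tag n =? 1) && fires R1 (arg n) (stage n)) ||
  (((tag n =? 2) || (tag n =? 3)) && fires R2 (arg n) (stage n)) ||
  ((tag n =? 4) && (arg n <? m)).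

(** Under tag 1 the injury count is part of the class name, so each injury makes a row abandon its
    class and start another. *)
Definition key (n : nat) : nat :=
  pair (tag n) (pair (arg n) (if tag n =? 1 then injuries R1 (arg n) (stage n) else 0)).

(** Inactive numbers become singletons, which keeps the universe all of [nat] without adding
    infinite classes. *)
Definition label (n : nat) : nat := if active n then pair 1 (key n) else pair 0 n.

Definition label_str : str := Str (fun _ => True) (fun x y => label x = label y).

Lemma label_str_eq : is_eq_str label_str.
Proof. split; [|split]; cbn; intros; congruence. Qed.

Lemma label_eq x y : label x = label y <->
  x = y \/ (active x = true /\ active y = true /\ key x = key y).
Proof.
  split; unfold label.
  - intros H. destruct (active x), (active y); apply pair_inj in H as [H H'];
      try discriminate; auto.
  - intros [->|(-> & -> & ->)]; reflexivity.
Qed.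

Definition element (t a s : nat) : nat := pair t (pair a s).

Lemma element_surjective n : n = element (tag n) (arg n) (stage n).
Proof. unfold element, tag, arg, stage. now rewrite !pair_surjective. Qed.

Lemma active_element t a s : active (element t a s) = true <->
  (t = 0 /\ s <= a) \/ (t = 1 /\ fires R1 a s = true) \/
  ((t = 2 \/ t = 3) /\ fires R2 a s = true) \/ (t = 4 /\ a < m).
Proof.
  unfold active, element, tag, arg, stage. unpair.
  rewrite !orb_true_iff, !andb_true_iff, orb_true_iff, !Nat.eqb_eq, Nat.leb_le, Nat.ltb_lt.
  tauto.
Qed.

Lemma key_element t a s :
  key (element t a s) = pair t (pair a (if t =? 1 then injuries R1 a s else 0)).
Proof. unfold key, element, tag, arg, stage. now unpair. Qed.

Lemma infinite_label_class t a s : infinite_class label_str (element t a s) <->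
  infinite_set (fun u => active (element t a s) = true /\
    active (element t a u) = true /\ key (element t a s) = key (element t a u)).
Proof.
  split; intros H n.
  - destruct (list_bound (element t a s :: map (element t a) (seq 0 n))) as [b Hb].
    destruct (H b) as (y & Hy & _ & E). cbn in E. apply label_eq in E as [<-|(H1 & H2 & H3)].
    + specialize (Hb _ (or_introl eq_refl)). lia.
    + rewrite (element_surjective y) in H2, H3, Hy.
      assert (tag y = t /\ arg y = a) as [Ht Ha].
      { rewrite !key_element in H3. apply pair_inj in H3 as [-> H3].
        now apply pair_inj in H3 as [-> _]. }
      rewrite Ht, Ha in *. exists (stage y). split; [|now split].
      apply Nat.nlt_ge. intros Hlt.
      specialize (Hb (element t a (stage y))). apply (Nat.lt_irrefl b).
      eapply Nat.le_lt_trans; [apply Hy|]. apply Hb. right. apply in_map, in_seq. lia.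
  - destruct (H n) as (u & Hu & E). exists (element t a u). split; [|split].
    + unfold element. pose proof (pair_ge a u). pose proof (pair_ge t (pair a u)). lia.
    + exact I.
    + apply label_eq. now right.
Qed.

Lemma injuries_bounded a : (forall a', a' < a -> ~ total_row R1 a') ->
  exists n, forall s, n <= s -> injuries R1 a s = injuries R1 a n.
Proof.
  intros H.
  assert (Hn : exists n, forall s, n <= s -> injured R1 a s = false).
  { assert (Hn : forall a0, a0 <= a -> exists n, forall s, n <= s ->
      forall a', a' < a0 -> fires R1 a' s = false).
    { induction a0 as [|a0 IH]; intros Ha; [exists 0; lia|].
      destruct IH as [n Hn]; [lia|]. specialize (H a0 Ha).
      rewrite <- fires_infinitely_often in H. apply not_infinite_set in H as [n' Hn'].
      exists (n + n'). intros s Hs a' Ha'. destruct (Nat.eq_dec a' a0) as [->|].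
      - apply not_true_is_false, Hn'. lia.
      - apply Hn; lia. }
    destruct (Hn a) as [n Hn']; trivial. exists n. intros s Hs.
    apply not_true_is_false. rewrite injured_iff. intros (a' & Ha & Hf).
    rewrite Hn' in Hf by trivial. discriminate. }
  destruct Hn as [n Hn]. exists n. induction 1 as [|s Hs IH]; trivial.
  unfold injuries in *. now rewrite count_S, IH, Hn.
Qed.

(** A smaller total row injures [a] again and again, so each injury count lasts only finitely
    long. *)
Lemma injuries_unbounded a a' : a' < a -> total_row R1 a' ->
  forall i, ~ infinite_set (fun s => injuries R1 a s = i).
Proof.
  intros Ha Ho i Hi. apply fires_infinitely_often in Ho.
  destruct (Hi 0) as (s & _ & Hs). destruct (Ho s) as (t & Ht & Hf).
  destruct (Hi (S t)) as (u & Hu & Hiu). unfold injuries in *.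
  pose proof (count_mono (injured R1 a) _ _ Hu) as H. rewrite count_S in H.
  rewrite (proj2 (injured_iff R1 a t)) in H by eauto.
  pose proof (count_mono (injured R1 a) _ _ Ht). cbn in H. lia.
Qed.

Lemma infinite_label_class_cases x : infinite_class label_str x ->
  (tag x = 1 /\ total_row R1 (arg x) /\ (forall a, a < arg x -> ~ total_row R1 a) /\
     active x = true /\ infinite_set (fun s => injuries R1 (arg x) s =
       injuries R1 (arg x) (stage x))) \/
  ((tag x = 2 \/ tag x = 3) /\ total_row R2 (arg x)) \/ (tag x = 4 /\ arg x < m /\ active x = true).
Proof.
  rewrite (element_surjective x) at 1. intros H%infinite_label_class.
  rewrite <- (element_surjective x) in H.
  destruct (H 0) as (_ & _ & Hx & _).
  pose proof Hx as Hc. rewrite (element_surjective x), active_element in Hc.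
  destruct Hc as [(E & _)|[(E & _)|[(E & _)|(E & Hm)]]].
  - exfalso. destruct (H (S (arg x))) as (u & Hu & _ & Hu' & _).
    apply active_element in Hu'. lia.
  - left. split; trivial.
    assert (Hinj : infinite_set (fun s => injuries R1 (arg x) s =
       injuries R1 (arg x) (stage x))).
    { revert H. apply infinite_set_le. intros u (_ & _ & Hk).
      rewrite (element_surjective x) in Hk at 1. rewrite !key_element, E in Hk.
      cbn in Hk. apply pair_inj in Hk as [_ Hk]. now apply pair_inj in Hk. }
    split; [|repeat split; trivial].
    + apply fires_infinitely_often. revert H. apply infinite_set_le.
      intros u (_ & Hu & _). apply active_element in Hu. intuition lia.
    + intros a Ha Ho. now apply (injuries_unbounded _ _ Ha Ho) in Hinj.
  - right. left. split; trivial. apply fires_infinitely_often.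
    revert H. apply infinite_set_le. intros u (_ & Hu & _).
    apply active_element in Hu. intuition lia.
  - right. right. auto.
Qed.

Lemma label_unbounded_finite : unbounded_finite label_str.
Proof.
  intros N. exists (element 0 N 0). split; [exact I|]. split.
  - intros H%infinite_label_class_cases. unfold tag, element in H.
    rewrite pfst_pair in H. lia.
  - exists (map (element 0 N) (seq 0 N)). split; [|split].
    + apply NoDup_map_NoDup_ForallPairs; [|apply seq_NoDup]. intros u v _ _ E.
      apply pair_inj in E as [_ E]. now apply pair_inj in E.
    + now rewrite length_map, length_seq.
    + intros y (u & <- & Hu%in_seq)%in_map_iff. split; [exact I|].
      apply label_eq. right. rewrite !active_element, !key_element.
      repeat split; trivial; left; lia.
Qed.

Lemma infinite_class_4 a s : a < m -> infinite_class label_str (element 4 a s).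
Proof.
  intros Ha. apply infinite_label_class. intros n. exists n.
  rewrite !active_element, !key_element. repeat split; trivial; lia.
Qed.

Lemma infinite_class_23 t a : t = 2 \/ t = 3 -> total_row R2 a ->
  exists s, infinite_class label_str (element t a s).
Proof.
  intros Ht Ha. apply fires_infinitely_often in Ha.
  destruct (Ha 0) as (s & _ & Hs). exists s. apply infinite_label_class.
  revert Ha. apply infinite_set_le. intros u Hu.
  rewrite !active_element, !key_element. destruct Ht as [-> | ->]; intuition.
Qed.

(** The least total row is injured finitely often, so its firings after the last injury all share
    one key. *)
Lemma infinite_class_1 : (exists a, total_row R1 a) ->
  exists a s, infinite_class label_str (element 1 a s).
Proof.
  intros (a & Ha & Hmin)%least_witness. exists a.
  destruct (injuries_bounded a Hmin) as [n Hn].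
  apply fires_infinitely_often in Ha.
  destruct (Ha n) as (s & Hs & Hfs). exists s. apply infinite_label_class.
  intros k. destruct (Ha (n + k)) as (u & Hu & Hfu). exists u. split; [lia|].
  rewrite !active_element, !key_element. cbn. rewrite (Hn s), (Hn u) by lia. intuition.
Qed.

Lemma label_rel_key x y : rel label_str x y -> tag x = tag y /\
  (tag x <> 0 -> active x = true -> arg x = arg y).
Proof.
  cbn. intros [->|(_ & _ & E)]%label_eq; [auto|]. unfold key in E.
  apply pair_inj in E as [-> E]. now apply pair_inj in E as [-> _].
Qed.

Lemma tag_element t a s : tag (element t a s) = t.
Proof. apply pfst_pair. Qed.

Lemma arg_element t a s : arg (element t a s) = a.
Proof. unfold arg, element. now unpair. Qed.

Lemma label_inf_classes_ge_2 : (exists a, total_row R2 a) -> inf_classes_ge label_str (2 + m).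
Proof.
  intros [a Ha].
  destruct (infinite_class_23 2 a) as [s2 H2]; auto.
  destruct (infinite_class_23 3 a) as [s3 H3]; auto.
  exists (fun i => if i <? m then element 4 i 0
                   else if i =? m then element 2 a s2 else element 3 a s3). split.
  - intros i Hi. split; [exact I|]. destruct (Nat.ltb_spec i m), (Nat.eqb_spec i m);
      trivial; now apply infinite_class_4.
  - intros i j Hi Hj [E1 E2]%label_rel_key.
    destruct (Nat.ltb_spec i m), (Nat.ltb_spec j m), (Nat.eqb_spec i m), (Nat.eqb_spec j m);
      rewrite ?tag_element, ?arg_element in *; try lia.
    apply E2; [lia|]. apply active_element. lia.
Qed.

Lemma label_inf_classes_ge_1 : (exists a, total_row R1 a) -> inf_classes_ge label_str (1 + m).
Proof.
  intros (a & s & H)%infinite_class_1.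
  exists (fun i => if i <? m then element 4 i 0 else element 1 a s). split.
  - intros i Hi. split; [exact I|]. destruct (Nat.ltb_spec i m);
      trivial; now apply infinite_class_4.
  - intros i j Hi Hj [E1 E2]%label_rel_key.
    destruct (Nat.ltb_spec i m), (Nat.ltb_spec j m);
      rewrite ?tag_element, ?arg_element in *; try lia.
    apply E2; [lia|]. apply active_element. lia.
Qed.

(** Pigeonhole: [c] colours the infinite classes with [k] colours, and equal colours mean the same
    class. *)
Lemma inf_classes_bound S k (c : nat -> nat) :
  (forall x, dom S x -> infinite_class S x -> c x < k) ->
  (forall x y, dom S x -> dom S y -> infinite_class S x -> infinite_class S y ->
     c x = c y -> rel S x y) ->
  ~ inf_classes_ge S (1 + k).
Proof.
  intros Hk Hc (r & Hr & Hinj).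
  enough (length (map (fun i => c (r i)) (seq 0 (1 + k))) <= length (seq 0 k))
    by (rewrite length_map, !length_seq in *; lia).
  apply NoDup_incl_length.
  - apply NoDup_map_NoDup_ForallPairs; [|apply seq_NoDup].
    intros i j Hi%in_seq Hj%in_seq E. apply Hinj; [lia..|].
    destruct (Hr i), (Hr j); try lia. auto.
  - intros y (i & <- & Hi%in_seq)%in_map_iff. apply in_seq.
    destruct (Hr i); [lia|]. split; [lia|]. now apply Hk.
Qed.

Lemma label_class_4_rel x y : tag x = 4 -> tag y = 4 -> active x = true ->
  active y = true -> arg x = arg y -> rel label_str x y.
Proof.
  intros Hx Hy Hax Hay E. apply label_eq. right. unfold key. rewrite Hx, Hy, E. auto.
Qed.

(** Tag 4 classes are coloured by their row and every other infinite class by [m]. Without a total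
    row of [R2] the latter have tag 1 and belong to the same least total row of [R1]. *)
Lemma label_inf_classes_le_1 : ~ (exists a, total_row R2 a) ->
  ~ inf_classes_ge label_str (2 + m).
Proof.
  intros Hn. apply (inf_classes_bound _ (1 + m) (fun x => if tag x =? 4 then arg x else m)).
  - intros x _ Hx. destruct (Nat.eqb_spec (tag x) 4) as [E|E]; [|lia].
    apply infinite_label_class_cases in Hx. lia.
  - intros x y _ _ Hx Hy.
    apply infinite_label_class_cases in Hx as [(Ex & Hx & Mx & Ax & Ix)|[[_ Hx]|(Ex & Hx & Ax)]];
      [|exfalso; eauto|];
    (apply infinite_label_class_cases in Hy as [(Ey & Hy & My & Ay & Iy)|[[_ Hy]|(Ey & Hy & Ay)]];
      [|exfalso; eauto|]); rewrite Ex, Ey; cbn [Nat.eqb]; intros E; try lia.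
    + apply label_eq. right. split; [|split]; trivial. unfold key. rewrite Ex, Ey. cbn.
      assert (Exy : arg x = arg y).
      { destruct (Nat.lt_trichotomy (arg x) (arg y)) as [h|[h|h]]; trivial; exfalso.
        - now apply (My (arg x)).
        - now apply (Mx (arg y)). }
      rewrite <- Exy in *. do 2 f_equal.
      destruct (injuries_bounded (arg x) Mx) as [n Hi].
      (* Each of the two injury counts recurs at arbitrarily late stages, so both equal the final
         one. *)
      destruct (Ix n) as (u & Hu & <-), (Iy n) as (v & Hv & <-).
      now rewrite (Hi u), (Hi v).
    + now apply label_class_4_rel.
Qed.

Lemma label_inf_classes_le_0 : ~ (exists a, total_row R1 a) -> ~ (exists a, total_row R2 a) ->
  ~ inf_classes_ge label_str (1 + m).
Proof.
  intros Hn1 Hn2. apply (inf_classes_bound _ m arg).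
  - intros x _ [(_ & H & _)|[[_ H]|H]]%infinite_label_class_cases; [exfalso; eauto..|tauto].
  - intros x y _ _ [(_ & Hx & _)|[[_ Hx]|Hx]]%infinite_label_class_cases
      [(_ & Hy & _)|[[_ Hy]|Hy]]%infinite_label_class_cases E; try (exfalso; eauto; fail).
    apply label_class_4_rel; tauto.
Qed.

End Labels.

Lemma inf_classes_ge_le S j k : j <= k -> inf_classes_ge S k -> inf_classes_ge S j.
Proof.
  intros Hle (r & H1 & H2). exists r. split; intros; [apply H1|apply H2]; trivial; lia.
Qed.

Definition slice (R : nat -> bool) (x a b c : nat) : bool := R (pair x (pair a (pair b c))).

Section Computability.
Context (R : nat -> bool) (HR : computable_bool R).

Lemma computable_progress x a s : computable x -> computable a -> computable s ->
  computable (fun v => progress (slice R (x v)) (a v) (s v)).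
Proof.
  intros Hx Ha Hs. unfold progress.
  apply (computable_nat_rect _ (fun v s p => p + b2n (slice R (x v) (a v) p (pfst s))));
    computability.
  apply (computable_bool_comp R); computability_with x; computability_with a.
Qed.

Lemma computable_fires x a s : computable x -> computable a -> computable s ->
  computable_bool (fun v => fires (slice R (x v)) (a v) (s v)).
Proof.
  intros Hx Ha Hs. apply (computable_bool_comp R); computability.
  now apply computable_progress.
Qed.

Lemma computable_injuries x a s : computable x -> computable a -> computable s ->
  computable (fun v => injuries (slice R (x v)) (a v) (s v)).
Proof.
  intros Hx Ha Hs.
  apply (computable_count (fun v t => injured (slice R (x v)) (a v) t)); trivial.
  apply computable_ltb; computability.
  apply (computable_count (fun v a' => fires (slice R (x (pfst v))) a' (psnd v)));
    [apply computable_fires|]; computability_with x; computability_with a.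
Qed.
End Computability.

Lemma label_str_index R1 R2 m : computable_bool R1 -> computable_bool R2 ->
  exists f, computable f /\ forall x y z,
    rel (Ce (f x)) y z <-> rel (label_str (slice R1 x) (slice R2 x) m) y z.
Proof.
  intros H1 H2.
  set (l x n := label (slice R1 x) (slice R2 x) m n).
  assert (Hl : computable (fun v => l (pfst v) (psnd v))).
  { unfold l, label, active, key.
    repeat first [computable_step | apply computable_fires | apply computable_injuries]. }
  destruct (computable_smn (fun x v => b2n (l x (pfst v) =? l x (psnd v)))) as (f & Hf & Hs).
  { computability; apply (computable_comp2 l); computability. }
  exists f. split; trivial. intros x y z. specialize (Hs x (pair y z)). cbn.
  rewrite pfst_pair, psnd_pair in Hs. fold (l x y) (l x z). split.
  - intros H. unfold phi in *. pose proof (ev_deterministic _ _ _ _ _ H Hs) as E.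
    destruct (Nat.eqb_spec (l x y) (l x z)); [assumption|discriminate].
  - intros E. now rewrite E, Nat.eqb_refl in Hs.
Qed.

(** * Bounded finite classes *)

(** [CMu CFst] halts on [v] iff [v = 0]. Run after a program for [K], it halts on its own index iff
    [K] denies that it does. *)
Lemma halting_undecidable K : is_char halting K -> ~ turing_red K empty_oracle.
Proof.
  intros HK HC. apply computable_iff in HC as [c Hc].
  set (e := encode (CComp (CMu CFst) c)).
  assert (He : halting e <-> K e = false).
  { unfold halting, phi, e at 1. setoid_rewrite prog_encode. split.
    - intros [y H]. inversion H as [| | | | | |g f x v z H1 H2| | | |]; subst.
      rewrite (ev_deterministic _ _ _ _ _ H1 (Hc e)) in H2.
      inversion H2 as [| | | | | | | | | |f x n H3 _]; subst.
      pose proof (ev_deterministic _ _ _ _ _ H3 (ev_fst _ _)) as E.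
      rewrite pfst_pair in E. now destruct (K e).
    - intros E. exists 0. econstructor; [apply Hc|]. fold e. rewrite E. cbn [b2n].
      constructor; [|lia]. rewrite <- (pfst_pair 0 0) at 2. constructor. }
  specialize (HK e). destruct (K e); intuition congruence.
Qed.

Definition finite_cover (S : str) (p : nat) (F : list nat) : Prop :=
  (forall r, In r F -> dom S r) /\
  forall x, dom S x -> size_ge S x p -> exists r, In r F /\ rel S r x.

(** Each listed class of [T] that meets the range of [f] is replaced by one preimage; embeddings
    never decrease class size. *)
Lemma finite_cover_embedding S T f p F : is_eq_str T -> embedding S T f ->
  finite_cover T p F -> exists G, finite_cover S p G.
Proof.
  intros (_ & HTs & HTt) Hf [HF1 HF2].
  enough (H : exists G, (forall r, In r G -> dom S r) /\
    forall x, dom S x -> (exists r, In r F /\ rel T r (f x)) ->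
      exists s, In s G /\ rel S s x).
  { destruct H as (G & HG1 & HG2). exists G. split; trivial. intros x Hx Hp.
    apply HG2; trivial. apply HF2; [now apply Hf|]. now apply (size_ge_embedding S). }
  clear HF2. induction F as [|r F IH].
  - exists nil. split; [contradiction|]. intros x _ (r & [] & _).
  - destruct IH as (G & HG1 & HG2); [intros; apply HF1; now right|].
    assert (Hr : dom T r) by (apply HF1; now left).
    destruct (classic (exists x, dom S x /\ rel T r (f x))) as [(y & Hy & Ey)|Hn].
    + exists (y :: G). split; [intros s [<-|Hs]; auto|].
      intros x Hx (s & [<-|Hs] & E).
      * exists y. split; [now left|]. apply Hf; trivial.
        apply (HTt _ r); trivial; try (now apply Hf). apply HTs; trivial. now apply Hf.
      * destruct (HG2 x Hx) as (s' & Hs' & E'); [eauto|]. exists s'. split; [now right|trivial].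
    + exists G. split; trivial. intros x Hx (s & [<-|Hs] & E); [exfalso|]; eauto.
Qed.

Lemma bounded_finite_cover A k : is_eq_str A ->
  inf_classes_ge A k -> ~ inf_classes_ge A (1 + k) -> ~ unbounded_finite A ->
  exists N F, finite_cover A N F.
Proof.
  intros HA (r & Hr & Hinj) Hn Hb. apply not_all_ex_not in Hb as [N HN].
  exists N, (map r (seq 0 k)). split.
  - intros y (i & <- & Hi%in_seq)%in_map_iff. apply Hr. lia.
  - intros x Hx Hsize.
    destruct (inf_classes_cover A k r x) as (i & Hi & E); trivial.
    + apply NNPP. intros Hfin. apply HN. eauto.
    + exists (r i). split; trivial. apply in_map, in_seq. lia.
Qed.

Lemma class_minimum S d r x : is_eq_str S -> decides S d r -> dom S x ->
  exists z, dom S z /\ rel S x z /\ count (member d r z) z = 0.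
Proof.
  intros HS HD Hx.
  destruct (count_hit (member d r x) (1 + x) 0) as (z & Hz & E).
  { cbn [plus]. rewrite count_S, (proj1 (member_spec _ _ _ HD x x)).
    - cbn. lia.
    - split; trivial. now apply (proj1 HS). }
  apply (member_spec _ _ _ HD) in Hz as [Hz Hxz]. exists z. repeat split; trivial.
  rewrite <- E. apply count_ext. intros w. symmetry. now apply (member_ext S).
Qed.

Lemma class_minimum_unique S d r x y : is_eq_str S -> decides S d r ->
  dom S x -> dom S y -> rel S x y ->
  count (member d r x) x = 0 -> count (member d r y) y = 0 -> x = y.
Proof.
  intros HS HD Hx Hy Hxy E1 E2. apply (count_inj (member d r x)).
  - apply (member_spec _ _ _ HD). split; trivial. now apply (proj1 HS).
  - now apply (member_spec _ _ _ HD).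
  - rewrite E1, <- E2. apply count_ext. intros w. symmetry. now apply (member_ext S).
Qed.

(* Enumerating by increasing least elements keeps the classes distinct. *)
Lemma computable_class_sequence T dT rT p G : is_eq_str T -> decides T dT rT ->
  computable_bool dT -> computable_bool (fun n => rT (pfst n) (psnd n)) ->
  (forall r, In r G -> dom T r) -> (forall F, ~ finite_cover T p F) ->
  exists c, computable c /\
    (forall n, dom T (c n) /\ size_ge T (c n) p /\
       forall r, In r G -> ~ rel T r (c n)) /\
    forall n m, rel T (c n) (c m) -> n = m.
Proof.
  intros HT HD Hcd Hcr HG Hcov. pose proof HT as (HTr & HTs & HTt).
  (* Having at least [p] members is only semidecidable, so the search also guesses a stage [s] that
     confirms it. *)
  set (good b z s := (b <? z) && (dT z && ((count (member dT rT z) z =? 0) &&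
    ((p <=? count (member dT rT z) s) && forallb (fun r => negb (rT r z)) G)))).
  assert (Hgood : forall b z s, good b z s = true <-> b < z /\ dom T z /\
    count (member dT rT z) z = 0 /\ p <= count (member dT rT z) s /\
    forall r, In r G -> ~ rel T r z).
  { intros b z s. unfold good. rewrite !andb_true_iff, Nat.ltb_lt, Nat.eqb_eq, Nat.leb_le,
      forallb_forall. destruct HD as [HDd HDr]. rewrite (HDd z).
    setoid_rewrite HDr. setoid_rewrite not_true_iff_false.
    setoid_rewrite negb_true_iff. reflexivity. }
  destruct (computable_search (fun b w => good b (pfst w) (psnd w))) as (g & Hcg & Hg).
  { unfold good. repeat apply computable_andb; computability.
    - apply (computable_bool_comp dT); computability.
    - apply computable_count_member; computability.
    - apply computable_count_member; computability.
    - clear HG Hgood good. induction G as [|r G IH]; cbn; computability.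
      apply (computable_bool_comp2 rT); computability. }
  (* If no candidate beyond [b] existed, every class of size [p] outside [G] would have its least
     element at most [b], and [G] with the domain up to [b] would be a finite cover. *)
  { intros b. apply NNPP. intros Hn.
    apply (Hcov (G ++ filter dT (seq 0 (1 + b)))). split.
    - intros r [Hr|Hr]%in_app_iff; auto. apply filter_In in Hr as [_ Hr]. now apply HD.
    - intros x Hx Hp.
      destruct (class_minimum T dT rT x) as (z & Hz & Hxz & E); trivial.
      destruct (classic (exists r, In r G /\ rel T r z)) as [(r & Hr & Erz)|HnG].
      + exists r. split; [apply in_app_iff; now left|]. apply (HTt _ z); auto.
      + exists z. split; [|auto]. apply in_app_iff. right. apply filter_In.
        split; [|now apply HD]. apply in_seq. split; [lia|]. apply Nat.nle_gt. intros Hle.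
        apply (size_ge_rel T x z) in Hp; trivial.
        apply (size_ge_count _ _ _ _ _ HD) in Hp as [s Hs].
        apply Hn. exists (pair z s). rewrite pfst_pair, psnd_pair. apply Hgood.
        repeat split; trivial. eauto. }
  set (c n := Nat.iter (1 + n) (fun b => pfst (g b)) 0).
  assert (Hc : forall n, exists b s, good b (c n) s = true).
  { intros n. unfold c. cbn [plus]. rewrite Nat.iter_succ. do 2 eexists. apply Hg. }
  assert (Hinc : forall n m, n < m -> c n < c m).
  { assert (Hstep : forall n, c n < c (1 + n)).
    { intros n. change (c n < pfst (g (c n))). eapply Hgood, Hg. }
    induction 1 as [|m Hlt IH]; [apply Hstep|]. exact (Nat.lt_trans _ _ _ IH (Hstep m)). }
  exists c. split; [|split].
  - apply (computable_iter (fun _ b => pfst (g b)) (fun _ => 0) S); computability.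
    + apply (computable_comp g); computability.
    + apply (computable_S (fun n => n)), computable_id.
  - intros n. destruct (Hc n) as (b & s & (_ & H1 & _ & H2 & H3)%Hgood).
    repeat split; trivial. apply (size_ge_count _ _ _ _ _ HD). eauto.
  - intros n m E. destruct (Hc n) as (b & s & (_ & H1 & H2 & _)%Hgood).
    destruct (Hc m) as (b' & s' & (_ & H3 & H4 & _)%Hgood).
    assert (Enm : c n = c m) by now apply (class_minimum_unique T dT rT).
    destruct (Nat.lt_trichotomy n m) as [h|[h|h]]; trivial; apply Hinc in h; lia.
Qed.

(** For the least threshold [q = S p], the classes of [S] outside the cover have size at most [p].
    By minimality and pullback along [f], [T] has no finite cover at [p], so fresh targets of size
    [p] never run out. *)
Lemma computable_embedding_of_cover S T f N F :
  is_eq_str S -> is_eq_str T -> computable_str S -> computable_str T ->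
  embedding S T f -> finite_cover S N F ->
  exists g, computable g /\ embedding S T g.
Proof.
  intros HS HT (dS & rS & HdS & HrS & HcS) (dT & rT & HdT & HrT & HcT) Hf HF.
  assert (decS : decides S dS rS) by now split.
  assert (decT : decides T dT rT) by now split.
  destruct (least_witness (fun p => exists F, finite_cover S p F)) as (q & [G HG] & Hmin);
    [now exists N, F|]. clear N F HF.
  assert (Hseq : exists c, computable c /\
    forall n, dom S n -> (forall r, In r G -> ~ rel S r n) -> dom T (c n) /\
      (forall N, size_ge S n N -> size_ge T (c n) N) /\
      (forall r, In r G -> ~ rel T (f r) (c n)) /\
      forall m, rel T (c n) (c m) -> n = m).
  { destruct q as [|p].
    (* At threshold 0 the cover meets every class, so the value 0 is never consulted. *)
    - exists (fun _ => 0). split; [computability|]. intros n Hn Hnr. exfalso.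
      destruct HG as [_ HG]. destruct (HG n Hn) as (r & Hr & E); [|now apply (Hnr r)].
      exists nil. repeat split; [constructor|cbn; lia|contradiction..].
    - destruct (computable_class_sequence T dT rT p (map f G)) as (c & Hc & H1 & H2);
        trivial; try apply HcT.
      + intros y (r & <- & Hr)%in_map_iff. apply Hf. now apply HG.
      + intros F HF. apply (Hmin p); [lia|]. now apply (finite_cover_embedding S T f p F).
      + exists c. split; trivial. intros n Hn Hnr. destruct (H1 n) as (h1 & h2 & h3).
        repeat split; auto.
        * intros M HM. apply (size_ge_le _ _ _ p); trivial.
          destruct (le_lt_dec M p) as [|Hlt]; trivial. exfalso.
          destruct HG as [_ HG]. destruct (HG n Hn) as (r & Hr & E); [|now apply (Hnr r)].
          now apply (size_ge_le _ _ _ M).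
        * intros r Hr. apply h3. now apply in_map. }
  destruct Hseq as (c & Hc & Hcn).
  (* Only the values of [f] on the finite list [G] enter, so [f] itself may be noncomputable. *)
  destruct (embedding_of_matching S T dS dT rS rT HS HT decS decT
    (map (fun r => (r, f r)) G) c) as (g & Hg & Hgc).
  - intros r c' (s & [= <- <-] & Hs)%in_map_iff.
    assert (dom S s) by now apply HG.
    split; [trivial|split]; [now apply Hf|]. intros N. now apply size_ge_embedding.
  - intros r1 c1 r2 c2 (s & [= <- <-] & Hs)%in_map_iff (t & [= <- <-] & Ht)%in_map_iff.
    apply Hf; now apply HG.
  - intros n Hn Hnr. destruct (Hcn n Hn) as (h1 & h2 & h3 & h4).
    { intros r Hr. apply (Hnr r (f r)). apply in_map_iff. eauto. }
    repeat split; auto. intros r c' (s & [= <- <-] & Hs)%in_map_iff. auto.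
  - exists g. split; trivial. now apply Hgc.
Qed.

(** Otherwise the empty oracle would compute all the required embeddings, and hence the halting
    set. *)
Lemma degree_0'_unbounded_finite A k : is_eq_str A -> bec_degree_is_0' A ->
  inf_classes_ge A k -> ~ inf_classes_ge A (1 + k) -> unbounded_finite A.
Proof.
  intros HA [_ Hdeg] H1 H2. apply NNPP. intros Hb.
  destruct (bounded_finite_cover A k) as (N & F & HF); trivial.
  assert (Hemb : forall S T, computable_str S -> is_eq_str S -> computable_str T ->
    is_eq_str T -> bi_embeddable S A -> bi_embeddable T A ->
    exists g, computable g /\ embedding S T g).
  { intros S T HcS HS HcT HT [[f Hf] _] [_ [g Hg]].
    destruct (finite_cover_embedding S A f N F) as [G HG]; trivial.
    apply (computable_embedding_of_cover S T (fun x => g (f x)) N G); trivial.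
    destruct Hf as (f1 & f2 & f3), Hg as (g1 & g2 & g3). split; [|split]; auto.
    intros x y Hx Hy. rewrite f3, g3 by auto. reflexivity. }
  set (K e := if excluded_middle_informative (halting e) then true else false).
  assert (HK : is_char halting K).
  { intros e. unfold K. now destruct excluded_middle_informative. }
  apply (halting_undecidable K HK), Hdeg; trivial.
  intros S T HcS HS HcT HT HSA HTA. split; now apply Hemb.
Qed.

(** * Index set membership and completeness *)

Lemma bi_embeddable_ext S S' A :
  (forall x, dom S x <-> dom S' x) -> (forall x y, rel S x y <-> rel S' x y) ->
  bi_embeddable S A -> bi_embeddable S' A.
Proof.
  intros Hd Hr [[f (f1 & f2 & f3)] [g (g1 & g2 & g3)]]. split; [exists f|exists g].
  - split; [|split]; intros *; rewrite <- ?Hd, <- ?Hr; auto.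
  - split; [|split]; intros *; rewrite <- ?Hd, <- ?Hr; auto.
Qed.

(** Label structures are always equivalence structures with unbounded finite classes, so only their
    number of infinite classes is left to decide membership. *)
Lemma index_set_label A k R1 R2 m : is_eq_str A ->
  inf_classes_ge A k -> ~ inf_classes_ge A (1 + k) -> unbounded_finite A ->
  computable_bool R1 -> computable_bool R2 ->
  exists f, computable f /\ forall x, index_set A (f x) <->
    inf_classes_ge (label_str (slice R1 x) (slice R2 x) m) k /\
    ~ inf_classes_ge (label_str (slice R1 x) (slice R2 x) m) (1 + k).
Proof.
  intros HA H1 H2 H3 HR1 HR2.
  destruct (label_str_index R1 R2 m HR1 HR2) as (f & Hf & Hrel).
  exists f. split; trivial. intros x. set (L := label_str _ _ m) in *.
  transitivity (bi_embeddable L A).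
  - split; apply bi_embeddable_ext; try reflexivity; intros y z; [|symmetry]; apply Hrel.
  - rewrite (bi_embeddable_unbounded A L k) by trivial.
    pose proof (label_str_eq (slice R1 x) (slice R2 x) m).
    pose proof (label_unbounded_finite (slice R1 x) (slice R2 x) m).
    unfold L. tauto.
Qed.

(** A Pi_3 condition is encoded through its counterexamples: total rows of the negated matrix. *)
Lemma not_total_row R x : (forall a, exists b, forall c, R (pair x (pair a (pair b c))) = true)
  <-> ~ exists a, total_row (slice (fun n => negb (R n)) x) a.
Proof.
  unfold total_row, slice. setoid_rewrite negb_true_iff. split.
  - intros H [a Ha]. destruct (H a) as [b Hb]. destruct (Ha b) as [c Hc]. congruence.
  - intros H a. apply NNPP. intros Hn. apply H. exists a. intros b.
    apply NNPP. intros Hc. apply Hn. exists b. intros c.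
    apply not_false_is_true. eauto.
Qed.

Lemma arith_index_set A k : is_eq_str A ->
  inf_classes_ge A k -> ~ inf_classes_ge A (1 + k) -> unbounded_finite A ->
  exists P, arith false 3 P /\
    forall e, index_set A e <-> inf_classes_ge (Ce e) k /\ P e.
Proof.
  intros HA H1 H2 H3.
  exists (fun e => is_eq_str (Ce e) /\ ~ inf_classes_ge (Ce e) (1 + k) /\
    unbounded_finite (Ce e)). split.
  - apply arith_and; [|apply arith_and].
    + apply (arith_lift false), arith_is_eq_str.
    + apply (arith_not true), arith_inf_classes_ge.
    + apply arith_unbounded_finite.
  - intros e. unfold index_set. rewrite (bi_embeddable_unbounded A (Ce e) k) by trivial.
    tauto.
Qed.

Lemma inf_classes_ge_0 S : inf_classes_ge S 0.
Proof. exists (fun _ => 0). split; lia. Qed.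

Theorem theorem4p3 (A : str) :
  computable_str A -> is_eq_str A -> bec_degree_is_0' A ->
  ((forall x, dom A x -> ~ infinite_class A x) ->
     complete Pi3 (index_set A)) /\
  (forall k, 0 < k -> has_k_infinite_classes A k ->
     complete D3 (index_set A)).
Proof.
  intros _ HA Hdeg. split.
  - intros Hfin. pose proof (inf_classes_ge_0 A) as H1.
    assert (H2 : ~ inf_classes_ge A 1).
    { intros (r & Hr & _). destruct (Hr 0) as [h1 h2]; [lia|]. now apply (Hfin (r 0)). }
    pose proof (degree_0'_unbounded_finite A 0 HA Hdeg H1 H2) as H3. split.
    + destruct (arith_index_set A 0) as (P & HP & HPA); trivial.
      apply Pi3_arith. revert HP. apply arith_ext. intros e. rewrite HPA.
      pose proof (inf_classes_ge_0 (Ce e)). tauto.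
    + intros T (R & HR & HT).
      (* The constantly false first relation and the value 0 for [m] remove tags 1 and 4, leaving
         either no infinite class or at least two. *)
      destruct (index_set_label A 0 (fun _ => false) (fun n => negb (R n)) 0)
        as (f & Hf & Hix); trivial; [computability..|].
      exists f. split; trivial. intros x. rewrite HT, not_total_row, Hix. split.
      * intros HS2. split; [apply inf_classes_ge_0|].
        apply label_inf_classes_le_0; trivial. intros [a Ha]. destruct (Ha 0) as [c Hc].
        discriminate.
      * intros [_ Hn] HS2. apply Hn. apply (inf_classes_ge_le _ _ 2); [lia|].
        now apply label_inf_classes_ge_2.
  - intros [|m] Hk Hinf; [lia|]. clear Hk.
    destruct (has_k_infinite_classes_ge A (S m) HA Hinf) as [H1 H2].
    pose proof (degree_0'_unbounded_finite A _ HA Hdeg H1 H2) as H3. split.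
    + destruct (arith_index_set A (S m)) as (P & HP & HPA); trivial.
      exists (fun e => inf_classes_ge (Ce e) (S m)), P. split; [|split; trivial].
      * apply Sigma3_arith, arith_inf_classes_ge.
      * now apply Pi3_arith.
    + intros T (S1 & S2 & (R1 & HR1 & HS1) & (R2 & HR2 & HS2) & HT).
      (* [m] is one less than the number of infinite classes of [A]; the Sigma_3 witness has to
         supply the missing class. *)
      destruct (index_set_label A (S m) R1 (fun n => negb (R2 n)) m)
        as (f & Hf & Hix); trivial; [computability|].
      exists f. split; trivial. intros x. rewrite HT, HS1, HS2, not_total_row, Hix. split.
      * intros [h1 h2]. split; [now apply label_inf_classes_ge_1|].
        now apply label_inf_classes_le_1.
      * intros [h1 h2].
        assert (h3 : ~ exists a, total_row (slice (fun n => negb (R2 n)) x) a).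
        { intros h3. apply h2. now apply label_inf_classes_ge_2. }
        split; trivial. apply NNPP. intros h4. revert h1. now apply label_inf_classes_le_0.
Qed.
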